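(* Let $I\subseteq\mathbb{R}$ be an open interval and let $a,d:I\to\mathbb{R}$ be real analytic functions with $a$ positive. The only solution $\phi$ (near $I\equiv I\times\{0\}$ in $\mathbb{C}$, $z=s+it$) to the Cauchy problem $$\Delta(\log\phi)=0,\qquad\phi(s,0)=a(s),\qquad\phi_t(s,0)=d(s)$$ is constructed as follows: choose $s_0\in I$ arbitrary, let $\theta:I\to\mathbb{R}$ be $$\theta(s)=-\frac12\int_{s_0}^s\frac{d(r)}{a(r)}\,dr,$$ and take holomorphic extensions $\sqrt{a}(z),\theta(z)$ of $\sqrt{a(s)},\theta(s)$. Then $\phi(s,t)=|f(z)|^2$, where $f$ is the holomorphic function $$f(z)=\sqrt{a}(z)\,e^{i\theta(z)}.$$
   Context: $\Delta=\partial_s^2+\partial_t^2$. *)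

(* Defs.v *)
From Stdlib Require Export Reals.
From Coquelicot Require Export Coquelicot.
Open Scope R_scope.

Definition is_open_interval (I : R -> Prop) : Prop :=
  exists alpha beta : Rbar,
    forall s : R, I s <-> Rbar_lt alpha s /\ Rbar_lt s beta.

Definition real_analytic_on (I : R -> Prop) (g : R -> R) : Prop :=
  forall x : R, I x ->
    exists (c : nat -> R) (r : R),
      0 < r /\ forall y : R, Rabs (y - x) < r -> is_pseries c (y - x) (g y).

(** [C] is [R * R]: the point [z = s + i t] is the pair [(s, t)], and
    [RtoC s = (s, 0)].  Functions on plane domains are total functions whose
    values off the domain are irrelevant. *)
Definition nbhd_of (I : R -> Prop) (U : C -> Prop) : Prop :=
  open U /\ forall s : R, I s -> U (RtoC s).

(** [ex_derive] is taken over the complex field here. *)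
Definition holomorphic_on (U : C -> Prop) (F : C -> C) : Prop :=
  forall z : C, U z -> @ex_derive C_AbsRing C_NormedModule F z.

Definition holomorphic_near (I : R -> Prop) (F : C -> C) : Prop :=
  exists U : C -> Prop, nbhd_of I U /\ holomorphic_on U F.

Definition holomorphic_extension
    (I : R -> Prop) (g : R -> R) (F : C -> C) : Prop :=
  holomorphic_near I F /\ forall s : R, I s -> F (RtoC s) = RtoC (g s).

Definition Cexp (z : C) : C :=
  (exp (Re z) * cos (Im z), exp (Re z) * sin (Im z)).

Definition laplacian (u : R -> R -> R) (s t : R) : R :=
  partial_derive 2 0 u s t + partial_derive 0 2 u s t.

(** Solutions are classical.  On an open set, [ex_diff_n phi 2] at every point
    says that [phi] is of class C^2.  Positivity gives [log phi] its meaning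
    ([ln] is [0] on nonpositive reals); as [phi = a > 0] on [I], it only
    restricts how far the domain may extend. *)
Definition cauchy_solution_on
    (I : R -> Prop) (a d : R -> R) (U : C -> Prop) (phi : R -> R -> R) : Prop :=
  (forall s t : R, U (s, t) ->
     ex_diff_n phi 2 s t /\ 0 < phi s t /\
     laplacian (fun x y => ln (phi x y)) s t = 0) /\
  (forall s : R, I s ->
     phi s 0 = a s /\ Derive (fun t => phi s t) 0 = d s).

Definition theta_from (a d : R -> R) (s0 s : R) : R :=
  - (1 / 2) * RInt (fun r => d r / a r) s0 s.

(* Main.v *)
(** A real analytic [g] on [I] extends near each point by its power series;
    two extensions agree where they overlap, so they glue.  Then [sqrt a] is
    [exp ((log a) / 2)] and [theta] is a primitive of [- d / (2 a)].  For [f]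
    holomorphic without zeros, [log |f|^2] is harmonic, and the Cauchy data of
    [|f|^2] are read off [f' / f] on [I].  If [phi] and [psi] are two solutions
    and [w = log phi - log psi], then [w_s - i w_t] is holomorphic by the
    Cauchy-Riemann equations and zero on [I], hence zero near [I] by the
    identity principle.

    Holomorphy means complex differentiability at each point, without
    continuity of the derivative, so the identity principle and the smoothness
    of [f] go through Goursat's theorem and Cauchy's integral formula. *)

Require Import Defs.
From Stdlib Require Import Reals Lra Lia Psatz ClassicalEpsilon FunctionalExtensionality.
From Coquelicot Require Import Coquelicot.
Open Scope R_scope.

(** * Complex differentiability and paths *)

(** The obstacle is to reach Cauchy's formula from pointwise differentiability. Goursat is pushed to
    functions holomorphic on a square except at one point, where they are merely continuous; the
    difference quotient of [G] at [z] is of this kind, so it has a primitive and its integral over a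
    circle is zero. What is left, the integral of [1 / (w - z)], is constant in [z], because its
    derivative is the integral of [1 / (w - z)^2], which has a primitive; its value is computed at
    the centre. This replaces winding numbers and homotopies.

    Connectedness arguments are avoided as well. The identity principle is applied only on discs
    centred on the real axis, to functions that vanish on a real segment through the centre.
    Extensions are compared only when they have the same centre, after recentring at [Re z]. In the
    uniqueness part, of the vanishing gradient of [w] just [w_t = 0] is kept: [w] is integrated
    along the vertical segment that starts on the real axis, and this segment stays in the disc. *)

Local Notation Cder F z l := (@is_derive C_AbsRing C_NormedModule F z l).
Local Notation Pder g t l := (@is_derive R_AbsRing C_R_NormedModule g t l).

Lemma sqrt2_le_2 : sqrt 2 <= 2.
Proof. left; apply sqrt_less; lra. Qed.

(** Balls of the product structure on [C] are squares, those of [Cmod] are discs. They are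
    comparable with ratio [sqrt 2], bounded by 2, whence the radius [r / 2]. *)
Lemma locally_Cmod (z : C) (P : C -> Prop) :
  locally z P <-> exists r : R, 0 < r /\ forall w : C, Cmod (w - z)%C < r -> P w.
Proof.
split.
- intros [e He]. exists e; split; [apply cond_pos|].
  intros w Hw. apply He. now apply C_NormedModule_mixin_compat1.
- intros (r & Hr & H).
  assert (0 < r / 2) as Hr2 by lra.
  exists (mkposreal _ Hr2). intros w Hw. apply H.
  apply (C_NormedModule_mixin_compat2 z w) in Hw. simpl in Hw.
  eapply Rlt_le_trans; [exact Hw|].
  assert (S2 := sqrt2_le_2).
  simpl. replace r with (2 * (r / 2)) at 2 by field.
  apply Rmult_le_compat_r; lra.
Qed.

(** All later estimates start from this form; [locally_C] exchanges the neighbourhoods of the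
    absolute ring for those of the product structure. *)
Lemma Cder_eps (F : C -> C) (z l : C) :
  Cder F z l <-> forall eps : R, 0 < eps -> exists r : R, 0 < r /\
    forall w : C, Cmod (w - z)%C < r ->
      Cmod (F w - F z - (w - z) * l)%C <= eps * Cmod (w - z)%C.
Proof.
split.
- intros [_ H] eps Heps.
  specialize (H z (fun P h => h) (mkposreal _ Heps)).
  apply locally_C, locally_Cmod in H.
  exact H.
- intros H; split.
  + apply is_linear_scal_l.
  + intros x Hx eps.
    apply (@is_filter_lim_locally_unique C_AbsRing (AbsRing_NormedModule C_AbsRing)) in Hx.
    subst x. apply locally_C, locally_Cmod. exact (H eps (cond_pos eps)).
Qed.

Lemma Pder_eps (g : R -> C) (t : R) (l : C) :
  Pder g t l <-> forall eps : R, 0 < eps -> exists r : R, 0 < r /\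
    forall s : R, Rabs (s - t) < r ->
      Cmod (g s - g t - RtoC (s - t) * l)%C <= eps * Rabs (s - t).
Proof.
(* Real scalars act componentwise in [C_R_NormedModule]; here the action is turned into complex
   multiplication. *)
assert (E : forall s : R, minus (minus (g s) (g t)) (@scal _ C_R_NormedModule (minus s t) l)
   = (g s - g t - RtoC (s - t) * l)%C).
{ intros s. apply injective_projections; unfold minus, plus, opp, scal; simpl;
  unfold plus, opp, scal; simpl; unfold scal; simpl; unfold mult; simpl; ring. }
split.
- intros [_ H] eps Heps.
  specialize (H t (fun P h => h) (mkposreal _ Heps)).
  destruct H as [r Hr]. exists r; split; [apply cond_pos|].
  intros s Hs. specialize (Hr s Hs). rewrite Cmod_norm, <- E. exact Hr.
- intros H; split.
  + apply (@is_linear_scal_l R_AbsRing C_R_NormedModule l).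
  + intros x Hx eps.
    apply (@is_filter_lim_locally_unique R_AbsRing R_NormedModule) in Hx; subst x.
    destruct (H eps (cond_pos eps)) as (r & Hr & Hs).
    exists (mkposreal _ Hr). intros s Bs. specialize (Hs s Bs).
    rewrite Cmod_norm, <- E in Hs. exact Hs.
Qed.

Lemma continuous_C_eps (g : R -> C) (t : R) :
  @continuous R_UniformSpace C_UniformSpace g t <->
  forall eps : R, 0 < eps -> exists r : R, 0 < r /\
    forall s : R, Rabs (s - t) < r -> Cmod (g s - g t)%C < eps.
Proof.
split.
- intros H eps He.
  assert (L : locally (g t) (fun w : C => Cmod (w - g t)%C < eps)).
  { apply locally_Cmod. exists eps; auto. }
  destruct (H _ L) as [r Hr]. exists r; split; [apply cond_pos|exact Hr].
- intros H P HP. apply locally_Cmod in HP. destruct HP as (e & He & HP).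
  destruct (H e He) as (r & Hr & Hs).
  exists (mkposreal _ Hr). intros s Bs. apply HP, Hs, Bs.
Qed.

Lemma Cder_continuous (F : C -> C) (z l : C) : Cder F z l ->
  forall eps : R, 0 < eps -> exists r : R, 0 < r /\
    forall w : C, Cmod (w - z)%C < r -> Cmod (F w - F z)%C < eps.
Proof.
intros H eps He. apply (Cder_eps F z l) with (eps := 1) in H; [|lra].
destruct H as (r & Hr & H).
assert (Hm : 0 < 1 + Cmod l) by (generalize (Cmod_ge_0 l); lra).
exists (Rmin r (eps / (2*(1 + Cmod l)))). split.
{ apply Rmin_pos; auto. apply Rdiv_lt_0_compat; lra. }
intros w Hw.
assert (H1 := H w (Rlt_le_trans _ _ _ Hw (Rmin_l _ _))).
assert (H2 := Rlt_le_trans _ _ _ Hw (Rmin_r _ _)).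
replace (F w - F z)%C with ((F w - F z - (w - z) * l) + (w - z) * l)%C by ring.
eapply Rle_lt_trans; [apply Cmod_triangle|]. rewrite Cmod_mult.
assert (H3 : Cmod (w - z)%C * (1 + Cmod l) <= eps / 2).
{ apply Rle_trans with (eps / (2*(1 + Cmod l)) * (1 + Cmod l)).
  apply Rmult_le_compat_r; lra. right; field; lra. }
lra.
Qed.

Lemma Pder_comp (F : C -> C) (g : R -> C) (t : R) (l m : C) :
  Cder F (g t) m -> Pder g t l -> Pder (fun s => F (g s)) t (l * m)%C.
Proof.
intros HF Hg. apply Pder_eps. intros eps He.
assert (Hl := Cmod_ge_0 l). assert (Hm := Cmod_ge_0 m).
(* The error splits into that of [F] at [g s] and [m] times that of [g]; [e1] and [e2] make each at
   most [eps / 2 * Rabs (s - t)]. The 1 in [Rmin 1 e2] gives [g] the local Lipschitz constant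
   [Cmod l + 1]. *)
set (e1 := eps / (2 * (Cmod l + 1))).
assert (He1 : 0 < e1) by (apply Rdiv_lt_0_compat; lra).
set (e2 := eps / (2 * (Cmod m + 1))).
assert (He2 : 0 < e2) by (apply Rdiv_lt_0_compat; lra).
destruct (proj1 (Cder_eps _ _ _) HF e1 He1) as (r1 & Hr1 & H1).
assert (He3 : 0 < Rmin 1 e2) by (apply Rmin_pos; lra).
destruct (proj1 (Pder_eps _ _ _) Hg _ He3) as (r2 & Hr2 & H2).
exists (Rmin r2 (r1 / (Cmod l + 1))). split.
{ apply Rmin_pos; auto. apply Rdiv_lt_0_compat; lra. }
intros s Hs.
assert (Hs2 := Rlt_le_trans _ _ _ Hs (Rmin_l _ _)).
assert (Hs1 := Rlt_le_trans _ _ _ Hs (Rmin_r _ _)).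
specialize (H2 s Hs2).
assert (Ha := Rabs_pos (s - t)).
assert (H3 : Cmod (g s - g t - RtoC (s - t) * l)%C <= Rabs (s-t)).
{ eapply Rle_trans; [exact H2|]. generalize (Rmin_l 1 e2). nra. }
assert (H4 : Cmod (g s - g t - RtoC (s - t) * l)%C <= e2 * Rabs (s-t)).
{ eapply Rle_trans; [exact H2|]. generalize (Rmin_r 1 e2). nra. }
assert (H5 : Cmod (g s - g t)%C <= Rabs (s - t) * (Cmod l + 1)).
{ replace (g s - g t)%C with ((g s - g t - RtoC (s - t) * l) + RtoC (s-t) * l)%C by ring.
  eapply Rle_trans; [apply Cmod_triangle|]. rewrite Cmod_mult, Cmod_R. lra. }
assert (H6 : Cmod (g s - g t)%C < r1).
{ eapply Rle_lt_trans; [exact H5|].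
  apply Rlt_le_trans with (r1 / (Cmod l + 1) * (Cmod l + 1)).
  apply Rmult_lt_compat_r; lra. right; field; lra. }
specialize (H1 _ H6).
replace (F (g s) - F (g t) - RtoC (s - t) * (l * m))%C with
 ((F (g s) - F (g t) - (g s - g t) * m) + (g s - g t - RtoC (s-t) * l) * m)%C by ring.
eapply Rle_trans; [apply Cmod_triangle|]. rewrite Cmod_mult.
assert (E1 : e1 * Cmod (g s - g t)%C <= eps / 2 * Rabs (s - t)).
{ apply Rle_trans with (e1 * (Rabs (s - t) * (Cmod l + 1))).
  apply Rmult_le_compat_l; lra. right; unfold e1; field; lra. }
assert (E2 : Cmod (g s - g t - RtoC (s - t) * l)%C * Cmod m <= eps / 2 * Rabs (s - t)).
{ apply Rle_trans with (e2 * Rabs (s - t) * (Cmod m + 1)).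
  apply Rmult_le_compat; try lra. apply Cmod_ge_0.
  right; unfold e2; field; lra. }
lra.
Qed.

Lemma Pder_pair (u v : R -> R) (t a b : R) :
  is_derive u t a -> is_derive v t b -> Pder (fun s => (u s, v s)) t (a, b).
Proof.
intros Hu Hv. apply Pder_eps. intros eps He.
assert (He2 : 0 < eps / 2) by lra.
destruct Hu as [_ Hu]. specialize (Hu t (fun P h => h) (mkposreal _ He2)).
destruct Hv as [_ Hv]. specialize (Hv t (fun P h => h) (mkposreal _ He2)).
destruct (filter_and _ _ Hu Hv) as [r Hr].
exists r; split; [apply cond_pos|]. intros s Hs.
destruct (Hr s Hs) as [A B]. clear Hr Hu Hv.
unfold minus, plus, opp, scal, norm in A, B; simpl in A, B.
unfold mult, abs in A, B; simpl in A, B.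
eapply Rle_trans; [apply Cmod_2Rmax|].
assert (S2 := sqrt2_le_2).
simpl fst; simpl snd.
assert (E : Rmax (Rabs (u s - u t - ((s-t) * a - 0 * b)))
                 (Rabs (v s - v t - ((s-t) * b + 0 * a))) <= eps / 2 * Rabs (s - t)).
{ apply Rmax_lub; [eapply Rle_trans; [|exact A]|eapply Rle_trans;[|exact B]];
  right; f_equal; ring. }
assert (0 <= Rmax (Rabs (u s - u t - ((s-t) * a - 0 * b)))
                 (Rabs (v s - v t - ((s-t) * b + 0 * a)))).
{ eapply Rle_trans; [|apply Rmax_l]. apply Rabs_pos. }
unfold Rminus in *. nra.
Qed.

Lemma Pder_fst (g : R -> C) (t : R) (l : C) :
  Pder g t l -> is_derive (fun s => fst (g s)) t (fst l).
Proof.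
intros H. apply is_derive_Reals. intros eps He.
assert (He2 : 0 < eps / 2) by lra.
destruct (proj1 (Pder_eps _ _ _) H _ He2) as (r & Hr & Hs).
exists (mkposreal _ Hr). intros h Hh0 Hh. simpl in Hh.
specialize (Hs (t + h)%R). replace (t + h - t)%R with h in Hs by ring.
specialize (Hs Hh).
assert (Hp := Rabs_pos_lt _ Hh0).
replace ((fst (g (t + h)%R) - fst (g t)) / h - fst l)%R with
 (Re (g (t + h)%R - g t - RtoC h * l)%C / h).
2:{ unfold Re; simpl. field; auto. }
unfold Rdiv at 1. rewrite Rabs_mult, Rabs_inv.
apply Rle_lt_trans with (eps / 2 * Rabs h * / Rabs h).
- apply Rmult_le_compat_r. left; now apply Rinv_0_lt_compat.
  eapply Rle_trans; [apply re_le_Cmod|exact Hs].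
- field_simplify; lra.
Qed.

(** Multiplication by [- Ci] turns imaginary parts into real parts and reduces this to
    [Pder_fst]. *)
Lemma Pder_snd (g : R -> C) (t : R) (l : C) :
  Pder g t l -> is_derive (fun s => snd (g s)) t (snd l).
Proof.
intros H.
assert (HC : Cder (fun z => (- Ci * z)%C) (g t) (- Ci)%C).
{ apply Cder_eps. intros eps He. exists 1; split; [lra|]. intros w _.
  replace (- Ci * w - - Ci * g t - (w - g t) * - Ci)%C with (RtoC 0) by ring.
  rewrite Cmod_0. generalize (Cmod_ge_0 (w - g t)%C). nra. }
assert (H2 := Pder_fst _ _ _ (Pder_comp _ _ _ _ _ HC H)).
replace (snd l) with (fst (l * - Ci)%C) by (simpl; ring).
eapply is_derive_ext; [|exact H2]. intros s; simpl. ring.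
Qed.

(** * Goursat's theorem *)

Local Notation CInt f a b := (@RInt C_R_CompleteNormedModule f a b).
Local Notation is_CInt f a b l := (@is_RInt C_R_NormedModule f a b l).
Local Notation ex_CInt f a b := (@ex_RInt C_R_NormedModule f a b).
Local Notation Ccont g t := (@continuous R_UniformSpace C_UniformSpace g t).

(** The fundamental theorem of calculus along the path [g], with the factors in the order that
    [Pder_comp] produces. *)
Lemma is_CInt_path (P G : C -> C) (g dg : R -> C) (a b : R) :
  (forall t, Rmin a b <= t <= Rmax a b ->
     Pder g t (dg t) /\ Cder P (g t) (G (g t)) /\ Ccont (fun t => dg t * G (g t))%C t) ->
  is_CInt (fun t => dg t * G (g t))%C a b (P (g b) - P (g a))%C.
Proof.
intros H.
apply (@is_RInt_derive C_R_CompleteNormedModule (fun t => P (g t)) (fun t => dg t * G (g t))%C).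
- intros t Ht. destruct (H t Ht) as (H1 & H2 & _). now apply Pder_comp.
- intros t Ht. apply (H t Ht).
Qed.

Lemma is_CInt_bound (f : R -> C) (a b M : R) (l : C) :
  (forall t, Rmin a b <= t <= Rmax a b -> Cmod (f t) <= M) ->
  is_CInt f a b l -> Cmod l <= Rabs (b - a) * M.
Proof.
intros H Hf. rewrite Cmod_norm.
apply (@norm_RInt_le_const_abs C_R_NormedModule f a b); auto.
intros t Ht. rewrite <- Cmod_norm. auto.
Qed.

Lemma is_CInt_minus (f g : R -> C) (a b : R) (l m : C) :
  is_CInt f a b l -> is_CInt g a b m ->
  is_CInt (fun t => f t - g t)%C a b (l - m)%C.
Proof. intros; now apply (@is_RInt_minus C_R_NormedModule). Qed.

Lemma Ccont_CInt (f : R -> C) (a b : R) :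
  (forall t, Rmin a b <= t <= Rmax a b -> Ccont f t) ->
  is_CInt f a b (CInt f a b).
Proof.
intros H. apply (@RInt_correct C_R_CompleteNormedModule).
apply (@ex_RInt_continuous C_R_CompleteNormedModule). exact H.
Qed.

Lemma CInt_Chasles (f : R -> C) (a b c : R) :
  ex_CInt f a b -> ex_CInt f b c -> (CInt f a b + CInt f b c)%C = CInt f a c.
Proof. apply (@RInt_Chasles C_R_CompleteNormedModule). Qed.

Lemma CInt_swap (f : R -> C) (a b : R) :
  ex_CInt f a b -> CInt f b a = (- CInt f a b)%C.
Proof. intros H. symmetry; now apply (@opp_RInt_swap C_R_CompleteNormedModule). Qed.

Definition Hint (F : C -> C) (y a b : R) : C := CInt (fun s => F (s, y)) a b.
Definition Vint (F : C -> C) (x c d : R) : C := CInt (fun t => Ci * F (x, t))%C c d.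

(** Counterclockwise contour integral when [x <= x'] and [y <= y']; the factor [Ci] in [Vint] is
    dz/dt on a vertical side. Other orders of the endpoints only affect the sign. *)
Definition boundary_int (F : C -> C) (x x' y y' : R) : C :=
  (Hint F y x x' + Vint F x' y y' - Hint F y' x x' - Vint F x y y')%C.

Local Notation Cdiff_at F z := (@ex_derive C_AbsRing C_NormedModule F z).

Definition Ccont_at (F : C -> C) (z : C) : Prop :=
  forall eps : R, 0 < eps -> exists r : R, 0 < r /\
    forall w : C, Cmod (w - z)%C < r -> Cmod (F w - F z)%C < eps.

Lemma Cdiff_cont (F : C -> C) (z : C) : Cdiff_at F z -> Ccont_at F z.
Proof. intros [l Hl]. exact (Cder_continuous F z l Hl). Qed.

(** The endpoints are unordered, because primitives are integrals from a base point in all four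
    directions. *)
Definition between (a b t : R) := Rmin a b <= t <= Rmax a b.

Definition hol_rect (F : C -> C) (x x' y y' : R) :=
  forall s t, between x x' s -> between y y' t -> Cdiff_at F (s, t).

Lemma Ccont_path (F : C -> C) (g : R -> C) (t : R) :
  Ccont_at F (g t) -> Ccont g t -> Ccont (fun s => F (g s)) t.
Proof.
intros HF Hg. apply continuous_C_eps. intros eps He.
destruct (HF eps He) as (r & Hr & H).
destruct (proj1 (continuous_C_eps _ _) Hg r Hr) as (r' & Hr' & H').
exists r'; split; auto.
Qed.

Lemma Cder_mult_const (c z : C) : Cder (fun w => c * w)%C z c.
Proof.
apply Cder_eps. intros eps He. exists 1; split; [lra|]. intros w _.
replace (c * w - c * z - (w - z) * c)%C with (RtoC 0) by ring.
rewrite Cmod_0. generalize (Cmod_ge_0 (w - z)%C). nra.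
Qed.

Lemma Ccont_mult_const (c : C) (g : R -> C) (t : R) :
  Ccont g t -> Ccont (fun s => c * g s)%C t.
Proof.
intros H. apply (Ccont_path (fun w => c * w)%C); auto.
apply Cdiff_cont. exists c. apply Cder_mult_const.
Qed.

Lemma Pder_Hline (y t : R) : Pder (fun s : R => ((s, y) : C)) t (RtoC 1).
Proof. apply Pder_pair. apply (@is_derive_id R_AbsRing). apply @is_derive_const. Qed.

Lemma Pder_Vline (x t : R) : Pder (fun s : R => ((x, s) : C)) t Ci.
Proof. apply Pder_pair. apply @is_derive_const. apply (@is_derive_id R_AbsRing). Qed.

Lemma Pder_cont (g : R -> C) (t : R) (l : C) : Pder g t l -> Ccont g t.
Proof.
intros H. apply (@ex_derive_continuous R_AbsRing C_R_NormedModule). now exists l.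
Qed.

Lemma is_Hint (F : C -> C) (y a b : R) :
  (forall s, between a b s -> Ccont_at F (s, y)) ->
  is_CInt (fun s => F (s, y)) a b (Hint F y a b).
Proof.
intros H. apply Ccont_CInt. intros t Ht.
apply (Ccont_path F (fun s => (s, y))); auto.
eapply Pder_cont, Pder_Hline.
Qed.

Lemma is_Vint (F : C -> C) (x c d : R) :
  (forall t, between c d t -> Ccont_at F (x, t)) ->
  is_CInt (fun t => Ci * F (x, t))%C c d (Vint F x c d).
Proof.
intros H. apply Ccont_CInt. intros t Ht. apply Ccont_mult_const.
apply (Ccont_path F (fun s => (x, s))); auto.
eapply Pder_cont, Pder_Vline.
Qed.

Lemma between_l (a b : R) : between a b a.
Proof. unfold between; generalize (Rmin_l a b), (Rmax_l a b); lra. Qed.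
Lemma between_r (a b : R) : between a b b.
Proof. unfold between; generalize (Rmin_r a b), (Rmax_r a b); lra. Qed.
Lemma between_le (a b t : R) : a <= b -> between a b t -> a <= t <= b.
Proof. intros H; unfold between. rewrite Rmin_left, Rmax_right by lra. tauto. Qed.

Lemma Hint_Chasles_le (F : C -> C) (y a b c : R) : a <= b <= c ->
  (forall s, a <= s <= c -> Ccont_at F (s, y)) ->
  Hint F y a c = (Hint F y a b + Hint F y b c)%C.
Proof.
intros Hb H. symmetry. apply CInt_Chasles; eexists; apply is_Hint; intros s Hs;
apply between_le in Hs; try apply H; lra.
Qed.

Lemma Vint_Chasles_le (F : C -> C) (y a b c : R) : a <= b <= c ->
  (forall s, a <= s <= c -> Ccont_at F (y, s)) ->
  Vint F y a c = (Vint F y a b + Vint F y b c)%C.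
Proof.
intros Hb H. symmetry. apply CInt_Chasles; eexists; apply is_Vint; intros s Hs;
apply between_le in Hs; try apply H; lra.
Qed.

Lemma between_dist (a b t : R) : between a b t -> Rabs (t - a) <= Rabs (b - a).
Proof.
unfold between, Rmin, Rmax. intros K.
unfold Rabs; repeat destruct Rcase_abs; destruct Rle_dec; lra.
Qed.

Record rect := Rect { rl : R; rr : R; rb : R; rt : R }.

Definition hol_on_rect (F : C -> C) (q : rect) :=
  rl q <= rr q /\ rb q <= rt q /\
  forall s t, rl q <= s <= rr q -> rb q <= t <= rt q -> Cdiff_at F (s, t).

Definition halving (F : C -> C) (q q' : rect) :=
  rl q <= rl q' /\ rr q' <= rr q /\ rb q <= rb q' /\ rt q' <= rt q /\
  rr q' - rl q' = (rr q - rl q) / 2 /\ rt q' - rb q' = (rt q - rb q) / 2 /\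
  Cmod (boundary_int F (rl q) (rr q) (rb q) (rt q)) <=
  4 * Cmod (boundary_int F (rl q') (rr q') (rb q') (rt q')).

(** The inner edges cancel, so the contour integral is the sum of those of the four quarters, and
    one of them has at least a quarter of its modulus. *)
Lemma exists_half (F : C -> C) (q : rect) : hol_on_rect F q ->
  exists q', hol_on_rect F q' /\ halving F q q'.
Proof.
destruct q as [x x' y y']. intros (Hx & Hy & H). simpl in *.
set (m := (x + x') / 2). set (n := (y + y') / 2).
assert (Hm : x <= m <= x') by (unfold m; lra).
assert (Hn : y <= n <= y') by (unfold n; lra).
set (b1 := boundary_int F x m y n).
set (b2 := boundary_int F m x' y n).
set (b3 := boundary_int F x m n y').
set (b4 := boundary_int F m x' n y').
assert (E : boundary_int F x x' y y' = (b1 + b2 + b3 + b4)%C).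
{ unfold b1, b2, b3, b4, boundary_int.
  rewrite (Hint_Chasles_le F y x m x'), (Hint_Chasles_le F y' x m x'),
    (Vint_Chasles_le F x y n y'), (Vint_Chasles_le F x' y n y'); auto.
  ring.
  all: intros s Hs; apply Cdiff_cont, H; lra. }
assert (D : Cmod (boundary_int F x x' y y') <= Cmod b1 + Cmod b2 + Cmod b3 + Cmod b4).
{ rewrite E. eapply Rle_trans; [apply Cmod_triangle|]. apply Rplus_le_compat_r.
  eapply Rle_trans; [apply Cmod_triangle|]. apply Rplus_le_compat_r.
  apply Cmod_triangle. }
set (B := Cmod (boundary_int F x x' y y')) in *.
assert (K : B <= 4 * Cmod b1 \/ B <= 4 * Cmod b2 \/ B <= 4 * Cmod b3 \/ B <= 4 * Cmod b4) by
lra.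
destruct K as [K|[K|[K|K]]];
[exists (Rect x m y n)|exists (Rect m x' y n)|exists (Rect x m n y')|exists (Rect m x' n y')];
(split; [split;[|split]|]); simpl; try lra;
try (intros s t Hs Ht; apply H; lra);
unfold halving; simpl; fold B; repeat split; try lra; try (unfold m; lra); try (unfold n;
lra); exact K.
Qed.

(** The point is the supremum of the left ends. *)
Lemma nested_point (u v : nat -> R) :
  (forall n, u n <= u (S n)) -> (forall n, v (S n) <= v n) -> (forall n, u n <= v n) ->
  exists l, forall n, u n <= l <= v n.
Proof.
intros Hu Hv Huv.
assert (Mu : forall n k, u n <= u (n + k)%nat).
{ intros n k; induction k. rewrite Nat.add_0_r; lra.
  rewrite Nat.add_succ_r. generalize (Hu (n + k)%nat); lra. }
assert (Mv : forall n k, v (n + k)%nat <= v n).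
{ intros n k; induction k. rewrite Nat.add_0_r; lra.
  rewrite Nat.add_succ_r. generalize (Hv (n + k)%nat); lra. }
assert (M : forall n k, u n <= v k).
{ intros n k. generalize (Mu n k) (Mv k n) (Huv (n + k)%nat).
  rewrite (Nat.add_comm k n). lra. }
destruct (completeness (fun x => exists n, x = u n)) as [l [L1 L2]].
- exists (v 0%nat). intros x [n ->]. apply M.
- now exists (u 0%nat), 0%nat.
- exists l; intros n; split.
  + apply L1. now exists n.
  + apply L2. intros x [k ->]. apply M.
Qed.

(** The affine function [A] has the primitive [P], whose corner values cancel around the contour.
    Only the deviation of [F] from [A] contributes, at most [M] times the perimeter. *)
Lemma boundary_int_bound (F : C -> C) (x x' y y' M : R) (al be z0 : C) :
  x <= x' -> y <= y' ->
  (forall s t, x <= s <= x' -> y <= t <= y' -> Ccont_at F (s, t)) ->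
  (forall s t, x <= s <= x' -> y <= t <= y' ->
     Cmod (F (s, t) - (al + be * ((s, t) - z0)))%C <= M) ->
  Cmod (boundary_int F x x' y y') <= 2 * M * ((x' - x) + (y' - y)).
Proof.
intros Hx Hy HF HM.
set (A := fun z : C => (al + be * (z - z0))%C).
set (P := fun z : C => (al * (z - z0) + be * (z - z0) * (z - z0) / 2)%C).
assert (HP : forall z, Cder P z (A z)).
{ intros z. apply Cder_eps. intros eps He.
  assert (Hb := Cmod_ge_0 be).
  exists (eps / (Cmod be + 1)). split. apply Rdiv_lt_0_compat; lra.
  intros w Hw.
  replace (P w - P z - (w - z) * A z)%C with (be / 2 * (w - z) * (w - z))%C.
  2:{ unfold P, A. field. }
  rewrite !Cmod_mult. apply Rmult_le_compat_r; [apply Cmod_ge_0|].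
  rewrite Cmod_div by (intros E; apply RtoC_inj in E; lra).
  rewrite Cmod_R, (Rabs_pos_eq 2) by lra.
  assert (H0 := Cmod_ge_0 (w - z)%C).
  apply Rle_trans with ((Cmod be + 1) * (eps / (Cmod be + 1))).
  2: right; field; lra. apply Rmult_le_compat; lra. }
assert (HA : forall z, Ccont_at A z).
{ intros z. apply Cdiff_cont. exists be. apply Cder_eps. intros eps He.
  exists 1; split; [lra|]. intros w _.
  replace (A w - A z - (w - z) * be)%C with (RtoC 0) by (unfold A; ring).
  rewrite Cmod_0. generalize (Cmod_ge_0 (w - z)%C). nra. }
assert (H1 : forall yy, y <= yy <= y' ->
  Cmod (Hint F yy x x' - (P (x', yy) - P (x, yy)))%C <= (x' - x) * M).
{ intros yy Hyy. rewrite <- (Rabs_pos_eq (x' - x)) by lra.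
  apply (is_CInt_bound (fun s => F (s, yy) - A (s, yy))%C).
  - intros t Ht. apply between_le in Ht; [|lra]. apply HM; lra.
  - apply is_CInt_minus.
    + apply is_Hint. intros s Hs. apply between_le in Hs; [|lra]. apply HF; lra.
    + eapply (@is_RInt_ext C_R_NormedModule).
      2: apply (is_CInt_path P A (fun s => (s, yy)) (fun _ => RtoC 1)).
      intros t _. apply Cmult_1_l.
      intros t _. split; [apply Pder_Hline|]. split; [apply HP|].
      apply Ccont_mult_const. apply (Ccont_path A (fun s => (s, yy))); auto.
      eapply Pder_cont, Pder_Hline. }
assert (H2 : forall xx, x <= xx <= x' ->
  Cmod (Vint F xx y y' - (P (xx, y') - P (xx, y)))%C <= (y' - y) * M).
{ intros xx Hxx. rewrite <- (Rabs_pos_eq (y' - y)) by lra.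
  apply (is_CInt_bound (fun t => Ci * F (xx, t) - Ci * A (xx, t))%C).
  - intros t Ht. apply between_le in Ht; [|lra].
    replace (Ci * F (xx, t) - Ci * A (xx, t))%C with (Ci * (F (xx,t) - A (xx,t)))%C by ring.
    rewrite Cmod_mult, Cmod_Ci, Rmult_1_l. apply HM; lra.
  - apply is_CInt_minus.
    + apply is_Vint. intros s Hs. apply between_le in Hs; [|lra]. apply HF; lra.
    + apply (is_CInt_path P A (fun t => (xx, t)) (fun _ => Ci)).
      intros t _. split; [apply Pder_Vline|]. split; [apply HP|].
      apply Ccont_mult_const. apply (Ccont_path A (fun s => (xx, s))); auto.
      eapply Pder_cont, Pder_Vline. }
assert (A1 := H1 y (conj (Rle_refl _) Hy)). assert (A2 := H1 y' (conj Hy (Rle_refl _))).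
assert (A3 := H2 x (conj (Rle_refl _) Hx)). assert (A4 := H2 x' (conj Hx (Rle_refl _))).
unfold boundary_int.
set (e1 := (Hint F y x x' - (P (x', y) - P (x, y)))%C) in *.
set (e2 := (Hint F y' x x' - (P (x', y') - P (x, y')))%C) in *.
set (e3 := (Vint F x y y' - (P (x, y') - P (x, y)))%C) in *.
set (e4 := (Vint F x' y y' - (P (x', y') - P (x', y)))%C) in *.
replace (Hint F y x x' + Vint F x' y y' - Hint F y' x x' - Vint F x y y')%C
 with (e1 + e4 + - e2 + - e3)%C by (unfold e1, e2, e3, e4; ring).
eapply Rle_trans; [apply Cmod_triangle|]. rewrite Cmod_opp.
assert (T1 := Cmod_triangle (e1 + e4)%C (- e2)%C). rewrite Cmod_opp in T1.
assert (T2 := Cmod_triangle e1 e4). lra.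
Qed.

(** Bisection. At the common point of the nested rectangles [F] is affine up to [ep] times the
    distance, so the n-th contour integral is at most a multiple of [ep / 4 ^ n]; this balances the
    factor [4 ^ n] lost by passing to quarters. *)
Lemma Goursat_le (F : C -> C) (x x' y y' : R) : x <= x' -> y <= y' ->
  (forall s t, x <= s <= x' -> y <= t <= y' -> Cdiff_at F (s, t)) ->
  boundary_int F x x' y y' = RtoC 0.
Proof.
intros Hx Hy H.
(* The implication stands under the existential so that the choice function [nx] is defined on every
   [rect]. *)
assert (Ch : forall q, exists q', hol_on_rect F q -> hol_on_rect F q' /\ halving F q q').
{ intros q. destruct (classic (hol_on_rect F q)) as [G|G].
  destruct (exists_half F q G) as [q' Hq]; now exists q'. now exists q. }
set (nx := fun q => proj1_sig (constructive_indefinite_description _ (Ch q))).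
assert (Hnx : forall q, hol_on_rect F q -> hol_on_rect F (nx q) /\ halving F q (nx q)).
{ intros q. unfold nx. destruct constructive_indefinite_description; auto. }
clearbody nx. clear Ch.
set (q := fix q n := match n with O => Rect x x' y y' | S n => nx (q n) end).
assert (Gq : forall n, hol_on_rect F (q n)).
{ induction n; [|now apply Hnx]. repeat split; simpl; auto. }
assert (Sq : forall n, halving F (q n) (q (S n))) by (intros n; apply Hnx, Gq).
destruct (nested_point (fun n => rl (q n)) (fun n => rr (q n))) as [xs Hxs].
{ intros n; apply Sq. } { intros n; apply Sq. } { intros n; apply Gq. }
destruct (nested_point (fun n => rb (q n)) (fun n => rt (q n))) as [ys Hys].
{ intros n; apply Sq. } { intros n; apply Sq. } { intros n; apply Gq. }
set (D := (x' - x) + (y' - y)).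
assert (HD : 0 <= D) by (unfold D; lra).
assert (Wq : forall n, (rr (q n) - rl (q n)) + (rt (q n) - rb (q n)) = D / 2 ^ n).
{ induction n. simpl; unfold D; lra.
  destruct (Sq n) as (_ & _ & _ & _ & E1 & E2 & _). rewrite E1, E2.
  replace (D / 2 ^ S n) with ((D / 2 ^ n) / 2). rewrite <- IHn; field.
  simpl; field. apply pow_nonzero; lra. }
assert (Bq : forall n, Cmod (boundary_int F x x' y y') <=
   4 ^ n * Cmod (boundary_int F (rl (q n)) (rr (q n)) (rb (q n)) (rt (q n)))).
{ induction n. simpl; lra.
  destruct (Sq n) as (_ & _ & _ & _ & _ & _ & B).
  eapply Rle_trans; [exact IHn|]. simpl pow.
  rewrite (Rmult_comm 4), Rmult_assoc. apply Rmult_le_compat_l; auto.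
  apply pow_le; lra. }
apply Cmod_eq_0. apply Rle_antisym; [|apply Cmod_ge_0].
apply le_epsilon. intros e He. rewrite Rplus_0_l.
destruct (H xs ys (Hxs 0%nat) (Hys 0%nat)) as [l Hl].
(* The final bound is [2 * ep * D * D]; [D + 1] avoids division by zero for a rectangle reduced to a
   point. *)
set (ep := e / (2 * (D + 1) * (D + 1))).
assert (Hep : 0 < ep) by (apply Rdiv_lt_0_compat; nra).
destruct (proj1 (Cder_eps _ _ _) Hl ep Hep) as (r & Hr & HF).
destruct (pow_lt_1_zero (/ 2)) with (y := r / (D + 1)) as [n Hn].
{ rewrite Rabs_pos_eq; lra. }
{ apply Rdiv_lt_0_compat; lra. }
specialize (Hn n (le_n n)). rewrite Rabs_pos_eq in Hn by (apply pow_le; lra).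
rewrite pow_inv in Hn.
assert (P2 : 0 < / 2 ^ n) by (apply Rinv_0_lt_compat, pow_lt; lra).
assert (Dr : D / 2 ^ n < r).
{ apply Rle_lt_trans with ((D + 1) * / 2 ^ n). unfold Rdiv. nra.
  apply Rlt_le_trans with ((D + 1) * (r / (D + 1))).
  apply Rmult_lt_compat_l; lra. right; field; lra. }
eapply Rle_trans; [apply (Bq n)|].
destruct (Gq n) as (G1 & G2 & G3).
assert (BB := boundary_int_bound F _ _ _ _ (ep * (D / 2 ^ n)) (F (xs, ys)) l (xs, ys) G1 G2
  (fun s t Hs Ht => Cdiff_cont _ _ (G3 s t Hs Ht))).
rewrite Wq in BB.
eapply Rle_trans.
{ apply Rmult_le_compat_l; [apply pow_le; lra|]. apply BB.
  intros s t Hs Ht.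
  assert (Hd : Cmod ((s, t) - (xs, ys))%C <= D / 2 ^ n).
  { rewrite <- Wq. replace ((s, t) - (xs, ys))%C with (RtoC (s - xs) + Ci * RtoC (t - ys))%C.
    2:{ apply injective_projections; simpl; ring. }
    eapply Rle_trans; [apply Cmod_triangle|]. rewrite Cmod_mult, Cmod_Ci, Rmult_1_l, !Cmod_R.
    specialize (Hxs n). specialize (Hys n). simpl in Hxs, Hys.
    apply Rplus_le_compat; apply Rabs_le; lra. }
  replace (F (s, t) - (F (xs, ys) + l * ((s, t) - (xs, ys))))%C
   with (F (s, t) - F (xs, ys) - ((s,t) - (xs, ys)) * l)%C by ring.
  eapply Rle_trans; [apply HF; lra|].
  apply Rmult_le_compat_l; lra. }
replace (4 ^ n * (2 * (ep * (D / 2 ^ n)) * (D / 2 ^ n))) with (2 * ep * D * D).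
2:{ replace 4 with (2 * 2) by ring. rewrite Rpow_mult_distr. field. apply pow_nonzero; lra. }
unfold ep. apply Rle_trans with (2 * (e / (2 * (D + 1) * (D + 1))) * (D + 1) * (D + 1)).
2: right; field; lra.
fold ep. nra.
Qed.

Lemma Hint_swap (F : C -> C) (y a b : R) :
  (forall s, between a b s -> Ccont_at F (s, y)) ->
  Hint F y b a = (- Hint F y a b)%C.
Proof. intros H. apply CInt_swap. eexists. now apply is_Hint. Qed.

Lemma Vint_swap (F : C -> C) (x c d : R) :
  (forall t, between c d t -> Ccont_at F (x, t)) ->
  Vint F x d c = (- Vint F x c d)%C.
Proof. intros H. apply CInt_swap. eexists. now apply is_Vint. Qed.

Lemma between_sym (a b t : R) : between a b t -> between b a t.
Proof. unfold between. now rewrite Rmin_comm, Rmax_comm. Qed.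

(** Exchanging two opposite endpoints changes only the sign, so the ordered case suffices. *)
Lemma Goursat (F : C -> C) (x x' y y' : R) :
  hol_rect F x x' y y' -> boundary_int F x x' y y' = RtoC 0.
Proof.
intros H.
assert (H0 : forall a b c d, a <= b -> c <= d -> hol_rect F a b c d -> boundary_int F a b c d
= RtoC 0).
{ intros a b c d Hab Hcd K. apply Goursat_le; auto.
  intros s t Hs Ht; apply K; unfold between; rewrite Rmin_left, Rmax_right; lra. }
assert (SH : hol_rect F x x' y y' -> boundary_int F x x' y y' = (- boundary_int F x' x y y')%C).
{ clear H; intros H. unfold boundary_int.
  rewrite (Hint_swap F y x x'), (Hint_swap F y' x x').
  ring.
  all: intros s Hs; apply Cdiff_cont, H; auto using between_l, between_r. }
assert (SV : forall x x', hol_rect F x x' y y' -> boundary_int F x x' y y' = (- boundary_int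
F x x' y' y)%C).
{ clear; intros x x' H. unfold boundary_int.
  rewrite (Vint_swap F x y y'), (Vint_swap F x' y y').
  ring.
  all: intros s Hs; apply Cdiff_cont, H; auto using between_l, between_r. }
assert (HX : hol_rect F x' x y y') by (intros s t Hs Ht; apply H; auto using between_sym).
assert (Z : forall z, z = RtoC 0 -> (- z)%C = RtoC 0) by (intros z ->; ring).
destruct (Rle_or_lt x x') as [Hx|Hx]; [|rewrite SH by auto; apply Z];
(destruct (Rle_or_lt y y') as [Hy|Hy]; [|rewrite SV by auto; apply Z]);
apply H0; try lra; auto; intros s t Hs Ht; (apply H || apply HX); auto using between_sym.
Qed.

(** * Primitives *)

(** A square and not a disc: with two points it contains the axis-parallel rectangle they span
    ([Sq_between]), hence both L-shaped paths between them. *)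
Definition Sq (z0 : C) (r : R) (z : C) : Prop :=
  Rabs (fst z - fst z0) < r /\ Rabs (snd z - snd z0) < r.

Lemma Sq_between (z0 : C) (r a b c d s t : R) :
  Sq z0 r (a, c) -> Sq z0 r (b, d) -> between a b s -> between c d t -> Sq z0 r (s, t).
Proof.
unfold Sq, between; simpl. intros [H1 H2] [H3 H4] H5 H6.
apply Rabs_def2 in H1, H2, H3, H4.
unfold Rmin, Rmax in H5, H6.
split; apply Rabs_def1; repeat destruct Rle_dec; lra.
Qed.

Lemma Cmod_pair_le (s t x y : R) : Cmod ((s, t) - (x, y))%C <= Rabs (s - x) + Rabs (t - y).
Proof.
replace ((s, t) - (x, y))%C with (RtoC (s - x) + Ci * RtoC (t - y))%C.
2:{ apply injective_projections; simpl; ring. }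
eapply Rle_trans; [apply Cmod_triangle|]. rewrite Cmod_mult, Cmod_Ci, Rmult_1_l, !Cmod_R.
lra.
Qed.

Lemma is_CInt_unique (f : R -> C) (a b : R) (l : C) : is_CInt f a b l -> CInt f a b = l.
Proof. apply (@is_RInt_unique C_R_CompleteNormedModule). Qed.

Lemma Hint_bound (F : C -> C) (y a b M : R) (c : C) :
  (forall s, between a b s -> Ccont_at F (s, y)) ->
  (forall s, between a b s -> Cmod (F (s, y) - c)%C <= M) ->
  Cmod (Hint F y a b - RtoC (b - a) * c)%C <= Rabs (b - a) * M.
Proof.
intros H HM. apply (is_CInt_bound (fun s => F (s, y) - c)%C); [exact HM|].
apply is_CInt_minus. now apply is_Hint.
replace (RtoC (b - a) * c)%C with (@scal R_AbsRing C_R_NormedModule (b - a) c).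
apply (@is_RInt_const C_R_NormedModule).
apply injective_projections; simpl; unfold scal; simpl; unfold mult; simpl; ring.
Qed.

Lemma Vint_bound (F : C -> C) (x a b M : R) (c : C) :
  (forall s, between a b s -> Ccont_at F (x, s)) ->
  (forall s, between a b s -> Cmod (F (x, s) - c)%C <= M) ->
  Cmod (Vint F x a b - RtoC (b - a) * (Ci * c))%C <= Rabs (b - a) * M.
Proof.
intros H HM. apply (is_CInt_bound (fun s => Ci * F (x, s) - Ci * c)%C).
- intros s Hs. replace (Ci * F (x, s) - Ci * c)%C with (Ci * (F (x, s) - c))%C by ring.
  rewrite Cmod_mult, Cmod_Ci, Rmult_1_l. auto.
- apply is_CInt_minus. now apply is_Vint.
  replace (RtoC (b - a) * (Ci * c))%C with (@scal R_AbsRing C_R_NormedModule (b - a) (Ci *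
  c)%C).
  apply (@is_RInt_const C_R_NormedModule).
  apply injective_projections; simpl; unfold scal; simpl; unfold mult; simpl; ring.
Qed.

Lemma Hint_Chasles (F : C -> C) (y a b c : R) :
  (forall s, between a b s -> Ccont_at F (s, y)) ->
  (forall s, between b c s -> Ccont_at F (s, y)) ->
  Hint F y a c = (Hint F y a b + Hint F y b c)%C.
Proof. intros H1 H2. symmetry. apply CInt_Chasles; eexists; now apply is_Hint. Qed.

Lemma Vint_Chasles (F : C -> C) (x a b c : R) :
  (forall s, between a b s -> Ccont_at F (x, s)) ->
  (forall s, between b c s -> Ccont_at F (x, s)) ->
  Vint F x a c = (Vint F x a b + Vint F x b c)%C.
Proof. intros H1 H2. symmetry. apply CInt_Chasles; eexists; now apply is_Vint. Qed.

Lemma between_conv (a b tau t : R) : 0 <= tau <= 1 ->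
  (between a (a + tau * (b - a)) t -> between a b t) /\
  (between (a + tau * (b - a)) b t -> between a b t).
Proof.
intros Ht. unfold between, Rmin, Rmax.
split; repeat destruct Rle_dec; nra.
Qed.

Lemma between_conv_ne (a b tau : R) : 0 < tau <= 1 -> a <> b ->
  ~ between (a + tau * (b - a)) b a.
Proof.
intros Ht Hab. unfold between, Rmin, Rmax.
destruct (Rdichotomy _ _ Hab); repeat destruct Rle_dec; nra.
Qed.

(** Cut off at the exceptional corner [(p, q)] a copy of the rectangle scaled by [tau]. The other
    two pieces avoid that corner and fall under [Goursat]; on the small piece [F] is bounded, and
    its perimeter tends to zero. *)
Lemma Goursat_corner (F : C -> C) (p x q y : R) :
  (forall s t, between p x s -> between q y t -> Ccont_at F (s, t)) ->
  (forall s t, between p x s -> between q y t -> (s, t) <> (p, q) -> Cdiff_at F (s, t)) ->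
  boundary_int F p x q y = RtoC 0.
Proof.
intros HC HD.
assert (Hpt : forall G a b, Hint G b a a = RtoC 0).
{ intros. apply is_CInt_unique. apply (@is_RInt_point C_R_NormedModule). }
assert (Vpt : forall G a b, Vint G b a a = RtoC 0).
{ intros. apply is_CInt_unique. apply (@is_RInt_point C_R_NormedModule). }
destruct (Req_dec p x) as [->|Npx].
{ unfold boundary_int. rewrite !Hpt. ring. }
destruct (Req_dec q y) as [->|Nqy].
{ unfold boundary_int. rewrite !Vpt. ring. }
assert (HT : forall tau, 0 < tau <= 1 ->
  boundary_int F p x q y = boundary_int F p (p + tau * (x - p)) q (q + tau * (y - q))).
{ intros tau Ht.
  assert (Ht' : 0 <= tau <= 1) by lra.
  set (xt := p + tau * (x - p)). set (yt := q + tau * (y - q)).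
  assert (Bx := fun t => between_conv p x tau t Ht'). fold xt in Bx.
  assert (By := fun t => between_conv q y tau t Ht'). fold yt in By.
  assert (Nx := between_conv_ne p x tau Ht Npx). fold xt in Nx.
  assert (Ny := between_conv_ne q y tau Ht Nqy). fold yt in Ny.
  assert (E1 : boundary_int F xt x q y = RtoC 0).
  { apply Goursat. intros s t Hs Hb. apply HD; auto. now apply (proj2 (Bx _)).
    intros E; injection E; intros; subst. contradiction. }
  assert (E2 : boundary_int F p xt yt y = RtoC 0).
  { apply Goursat. intros s t Hs Hb. apply HD; auto. now apply (proj1 (Bx _)).
    now apply (proj2 (By _)).
    intros E; injection E; intros; subst. contradiction. }
  assert (Mx : between p x xt) by apply Bx, between_l.
  assert (My : between q y yt) by apply By, between_l.
  replace (boundary_int F p x q y) with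
   (boundary_int F p xt q yt + boundary_int F xt x q y + boundary_int F p xt yt y)%C.
  rewrite E1, E2; ring.
  unfold boundary_int.
  rewrite (Hint_Chasles F q p xt x), (Hint_Chasles F y p xt x),
     (Vint_Chasles F p q yt y), (Vint_Chasles F xt q yt y).
  ring.
  all: intros s Hs; apply HC; auto using between_l, between_r;
  first [now apply (proj1 (Bx _)) | now apply (proj2 (Bx _)) | now apply (proj1 (By _)) | now
  apply (proj2 (By _))]. }
destruct (HC p q (between_l _ _) (between_l _ _) 1 Rlt_0_1) as (r & Hr & HF).
set (D := Rabs (x - p) + Rabs (y - q)).
assert (HDp : 0 <= D) by (unfold D; generalize (Rabs_pos (x-p)) (Rabs_pos (y-q)); lra).
apply Cmod_eq_0, Rle_antisym; [|apply Cmod_ge_0].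
apply le_epsilon. intros e He. rewrite Rplus_0_l.
(* The bound with [r] keeps the small rectangle where [F] is within 1 of [F (p, q)]; the bound with
   [e] makes its perimeter [2 * tau * D] at most [e]. The constant [F (p, q)] cancels around the
   contour. *)
set (tau := Rmin 1 (Rmin (r / (2 * (D + 1))) (e / (2 * (D + 1))))).
assert (Ht0 : 0 < tau) by (apply Rmin_pos; [lra|]; apply Rmin_pos; apply Rdiv_lt_0_compat; lra).
assert (Ht1 : tau <= 1) by apply Rmin_l.
assert (Ht2 : tau * (2 * (D + 1)) <= r).
{ apply Rle_trans with (r / (2 * (D + 1)) * (2 * (D + 1))).
  apply Rmult_le_compat_r; [lra|]. eapply Rle_trans; [apply Rmin_r|apply Rmin_l].
  right; field; lra. }
assert (Ht3 : tau * (2 * (D + 1)) <= e).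
{ apply Rle_trans with (e / (2 * (D + 1)) * (2 * (D + 1))).
  apply Rmult_le_compat_r; [lra|]. eapply Rle_trans; [apply Rmin_r|apply Rmin_r].
  right; field; lra. }
rewrite (HT tau) by lra.
assert (Ht' : 0 <= tau <= 1) by lra.
set (xt := p + tau * (x - p)). set (yt := q + tau * (y - q)).
assert (Bx := fun t => between_conv p x tau t Ht'). fold xt in Bx.
assert (By := fun t => between_conv q y tau t Ht'). fold yt in By.
assert (Lx : Rabs (xt - p) = tau * Rabs (x - p)).
{ unfold xt. replace (p + tau * (x - p) - p) with (tau * (x - p)) by ring.
  rewrite Rabs_mult, (Rabs_pos_eq tau); lra. }
assert (Ly : Rabs (yt - q) = tau * Rabs (y - q)).
{ unfold yt. replace (q + tau * (y - q) - q) with (tau * (y - q)) by ring.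
  rewrite Rabs_mult, (Rabs_pos_eq tau); lra. }
assert (HB : forall s t, between p xt s -> between q yt t -> Cmod (F (s, t) - F (p, q))%C <= 1).
{ intros s t Hs Hb. left. apply HF. eapply Rle_lt_trans; [apply Cmod_pair_le|].
  assert (A1 := between_dist _ _ _ Hs). assert (A2 := between_dist _ _ _ Hb). unfold D in *.
  nra. }
assert (HCC : forall s t, between p xt s -> between q yt t -> Ccont_at F (s, t)).
{ intros s t Hs Hb. apply HC. now apply (proj1 (Bx _)). now apply (proj1 (By _)). }
assert (I1 := Hint_bound F q p xt 1 (F (p,
q)) (fun s h => HCC _ _ h (between_l _ _)) (fun s h => HB _ _ h (between_l _ _))).
assert (I2 := Hint_bound F yt p xt 1 (F (p,
q)) (fun s h => HCC _ _ h (between_r _ _)) (fun s h => HB _ _ h (between_r _ _))).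
assert (I3 := Vint_bound F p q yt 1 (F (p,
q)) (fun s h => HCC _ _ (between_l _ _) h) (fun s h => HB _ _ (between_l _ _) h)).
assert (I4 := Vint_bound F xt q yt 1 (F (p,
q)) (fun s h => HCC _ _ (between_r _ _) h) (fun s h => HB _ _ (between_r _ _) h)).
unfold boundary_int.
match type of I1 with Cmod ?e <= _ => set (e1 := e) in * end.
match type of I2 with Cmod ?e <= _ => set (e2 := e) in * end.
match type of I3 with Cmod ?e <= _ => set (e3 := e) in * end.
match type of I4 with Cmod ?e <= _ => set (e4 := e) in * end.
replace (Hint F q p xt + Vint F xt q yt - Hint F yt p xt - Vint F p q yt)%C
 with (e1 + e4 + - e2 + - e3)%C by (unfold e1, e2, e3, e4; ring).
rewrite Lx in I1, I2. rewrite Ly in I3, I4.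
eapply Rle_trans; [apply Cmod_triangle|]. rewrite Cmod_opp.
assert (T1 := Cmod_triangle (e1 + e4)%C (- e2)%C). rewrite Cmod_opp in T1.
assert (T2 := Cmod_triangle e1 e4). unfold D in *. nra.
Qed.

Lemma Sq_open (z0 : C) (r : R) (z : C) : Sq z0 r z ->
  exists d, 0 < d /\ forall w, Cmod (w - z)%C < d -> Sq z0 r w.
Proof.
intros [H1 H2].
exists (Rmin (r - Rabs (fst z - fst z0)) (r - Rabs (snd z - snd z0))).
split. apply Rmin_pos; lra.
intros w Hw.
assert (M := Rmax_Cmod (w - z)%C). simpl in M.
assert (A1 := Rle_trans _ _ _ (Rmax_l _ _) M). assert (A2 := Rle_trans _ _ _ (Rmax_r _ _) M).
assert (B1 := Rlt_le_trans _ _ _ Hw (Rmin_l _ _)).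
assert (B2 := Rlt_le_trans _ _ _ Hw (Rmin_r _ _)).
split.
replace (fst w - fst z0) with ((fst w + - fst z) + (fst z - fst z0)) by ring.
eapply Rle_lt_trans; [apply Rabs_triang|]. lra.
replace (snd w - snd z0) with ((snd w + - snd z) + (snd z - snd z0)) by ring.
eapply Rle_lt_trans; [apply Rabs_triang|]. lra.
Qed.

(* At [p] only continuity is required: this makes difference quotients
   [(G w - G p) / (w - p)] admissible, from which Cauchy's formula follows. *)
Lemma primitive_exists (F : C -> C) (z0 p : C) (r : R) :
  Sq z0 r p ->
  (forall z, Sq z0 r z -> Ccont_at F z) ->
  (forall z, Sq z0 r z -> z <> p -> Cdiff_at F z) ->
  exists P : C -> C, forall z, Sq z0 r z -> Cder P z (F z).
Proof.
destruct p as [p q]. intros Hp HC HD.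
(* The path from [p] runs horizontally, then vertically. By [HP] the other L-shaped path gives the
   same value, so increments in either direction become integrals over one segment. *)
set (P := fun z : C => (Hint F q p (fst z) + Vint F (fst z) q (snd z))%C).
assert (HP : forall x y, Sq z0 r (x, y) -> P (x, y) = (Vint F p q y + Hint F y p x)%C).
{ intros x y Hxy.
  assert (B : boundary_int F p x q y = RtoC 0).
  { apply Goursat_corner.
    intros s t Hs Ht; apply HC; exact (Sq_between z0 r p x q y s t Hp Hxy Hs Ht).
    intros s t Hs Ht Hne; apply HD; [exact (Sq_between z0 r p x q y s t Hp Hxy Hs Ht)|exact
    Hne]. }
  unfold P; simpl. unfold boundary_int in B.
  replace (Hint F q p x + Vint F x q y)%C with
   (Hint F q p x + Vint F x q y - Hint F y p x - Vint F p q y + (Vint F p q y + Hint F y p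
   x))%C by ring.
  rewrite B. ring. }
exists P. intros [x y] Hxy. apply Cder_eps. intros eps He.
destruct (HC _ Hxy (eps / 2)) as (d1 & Hd1 & H1); [lra|].
destruct (Sq_open _ _ _ Hxy) as (d2 & Hd2 & H2).
exists (Rmin (d1 / 2) (d2 / 2)). split. apply Rmin_pos; lra.
intros [x' y'] Hw.
assert (W1 := Rlt_le_trans _ _ _ Hw (Rmin_l _ _)).
assert (W2 := Rlt_le_trans _ _ _ Hw (Rmin_r _ _)).
assert (M := Rmax_Cmod ((x', y') - (x, y))%C). simpl in M.
assert (A1 := Rle_trans _ _ _ (Rmax_l _ _) M). assert (A2 := Rle_trans _ _ _ (Rmax_r _ _) M).
set (dd := Cmod ((x', y') - (x, y))%C) in *.
change (Rabs (x' - x) <= dd) in A1. change (Rabs (y' - y) <= dd) in A2.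
assert (K : forall s t, between x x' s -> between y y' t -> Cmod ((s, t) - (x,
y))%C < d1 /\ Cmod ((s, t) - (x, y))%C < d2).
{ intros s t Hs Ht. assert (X1 := between_dist _ _ _ Hs). assert (X2 := between_dist _ _ _ Ht).
  generalize (Cmod_pair_le s t x y). lra. }
assert (Hw' : Sq z0 r (x', y')) by (apply H2; unfold dd in *; lra).
assert (Hxy' : Sq z0 r (x, y')) by (apply H2, K; [apply between_l|apply between_r]).
(* The horizontal increment at height [y'] uses [HP], the vertical one at abscissa [x] uses the
   definition of [P]. *)
assert (E : (P (x', y') - P (x, y))%C = (Hint F y' x x' + Vint F x y y')%C).
{ replace (P (x', y') - P (x, y))%C with ((P (x', y') - P (x, y')) + (P (x, y') - P (x,
  y)))%C by ring.
  f_equal.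
  - rewrite !HP by auto. rewrite (Hint_Chasles F y' p x x'). ring.
    intros s Hs. apply HC. apply (Sq_between z0 r p x q y'); auto. apply between_r.
    intros s Hs. apply HC. apply (Sq_between z0 r x x' y' y'); auto. apply between_r.
  - unfold P; simpl. rewrite (Vint_Chasles F x q y y'). ring.
    intros s Hs. apply HC. apply (Sq_between z0 r p x q y); auto. apply between_r.
    intros s Hs. apply HC. apply (Sq_between z0 r x x y y'); auto. apply between_r. }
rewrite E.
assert (I1 : Cmod (Hint F y' x x' - RtoC (x' - x) * F (x, y))%C <= Rabs (x' - x) * (eps / 2)).
{ apply Hint_bound; intros s Hs.
  apply HC, H2, K; auto; apply between_r.
  left. apply H1, K; auto; apply between_r. }
assert (I2 : Cmod (Vint F x y y' - RtoC (y' - y) * (Ci * F (x,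
y)))%C <= Rabs (y' - y) * (eps / 2)).
{ apply Vint_bound; intros s Hs.
  apply HC, H2, K; auto; apply between_l.
  left. apply H1, K; auto; apply between_l. }
replace (Hint F y' x x' + Vint F x y y' - ((x', y') - (x, y)) * F (x, y))%C with
 ((Hint F y' x x' - RtoC (x' - x) * F (x, y)) + (Vint F x y y' - RtoC (y' - y) * (Ci * F (x,
 y))))%C.
2:{ replace ((x', y') - (x, y))%C with (RtoC (x' - x) + Ci * RtoC (y' - y))%C.
    ring. apply injective_projections; simpl; ring. }
eapply Rle_trans; [apply Cmod_triangle|]. nra.
Qed.

(** * Calculus of complex derivatives and Cauchy-type integrals *)

(** The product and chain rules of the library take values in the ring as a module over itself,
    [Cder] in [C_NormedModule]. Both have the norm [Cmod], so the epsilon form is the same. *)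
Lemma Cder_AbsRing (F : C -> C) (z l : C) :
  Cder F z l <-> @is_derive C_AbsRing (AbsRing_NormedModule C_AbsRing) F z l.
Proof.
split.
- intros H. split; [apply is_linear_scal_l|].
  intros x Hx eps.
  apply (@is_filter_lim_locally_unique C_AbsRing (AbsRing_NormedModule C_AbsRing)) in Hx.
  subst x. apply locally_C, locally_Cmod.
  exact (proj1 (Cder_eps _ _ _) H eps (cond_pos eps)).
- intros [_ H]. apply Cder_eps. intros eps Heps.
  specialize (H z (fun P h => h) (mkposreal _ Heps)).
  apply locally_C, locally_Cmod in H. exact H.
Qed.

Lemma Cder_mult (F G : C -> C) (z l m : C) :
  Cder F z l -> Cder G z m -> Cder (fun w => F w * G w)%C z (l * G z + F z * m)%C.
Proof.
intros HF HG. apply Cder_AbsRing in HF, HG. apply Cder_AbsRing.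
apply (@is_derive_mult C_AbsRing F G z l m); [exact HF|exact HG|].
intros; apply Cmult_comm.
Qed.

Lemma Cder_comp (F G : C -> C) (z l m : C) :
  Cder F (G z) l -> Cder G z m -> Cder (fun w => F (G w)) z (l * m)%C.
Proof.
intros HF HG. apply Cder_AbsRing in HF, HG. rewrite Cmult_comm. apply Cder_AbsRing.
exact (@is_derive_comp C_AbsRing (AbsRing_NormedModule C_AbsRing) F G z l m HF HG).
Qed.

Lemma Cder_plus (F G : C -> C) (z l m : C) :
  Cder F z l -> Cder G z m -> Cder (fun w => F w + G w)%C z (l + m)%C.
Proof. apply @is_derive_plus. Qed.

Lemma Cder_minus (F G : C -> C) (z l m : C) :
  Cder F z l -> Cder G z m -> Cder (fun w => F w - G w)%C z (l - m)%C.
Proof. apply @is_derive_minus. Qed.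

Lemma Cder_const (c z : C) : Cder (fun _ => c) z (RtoC 0).
Proof. apply @is_derive_const. Qed.

Lemma Cder_id (z : C) : Cder (fun w => w) z (RtoC 1).
Proof. apply Cder_AbsRing. apply (@is_derive_id C_AbsRing). Qed.

Lemma Cder_scal (c : C) (F : C -> C) (z l : C) :
  Cder F z l -> Cder (fun w => c * F w)%C z (c * l)%C.
Proof.
intros H. apply (Cder_comp (fun w => c * w)%C); auto. apply Cder_mult_const.
Qed.

Lemma Cder_ext_near (F G : C -> C) (z l : C) (d : R) : 0 < d ->
  (forall w, Cmod (w - z)%C < d -> F w = G w) -> Cder F z l -> Cder G z l.
Proof.
intros Hd E HF. apply Cder_eps. intros eps He.
destruct (proj1 (Cder_eps _ _ _) HF eps He) as (r & Hr & H).
exists (Rmin d r). split. now apply Rmin_pos.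
intros w Hw. rewrite <- !E.
apply H. eapply Rlt_le_trans; [exact Hw|apply Rmin_r].
replace (z - z)%C with (RtoC 0) by ring. now rewrite Cmod_0.
eapply Rlt_le_trans; [exact Hw|apply Rmin_l].
Qed.

Lemma Cder_inv (z : C) : z <> RtoC 0 -> Cder Cinv z (- / (z * z))%C.
Proof.
intros Hz. assert (Hm := proj1 (Cmod_gt_0 z) Hz).
apply Cder_eps. intros eps He.
set (m := Cmod z) in *.
(* The error is [|w - z|^2 / (|w| |z|^2)]: the first bound keeps [|w| > m / 2], the second then
   makes the factor beside [|w - z|] at most [eps]. *)
exists (Rmin (m / 2) (eps * (m / 2) * (m * m))). split.
{ apply Rmin_pos. lra. apply Rmult_lt_0_compat; [nra|nra]. }
intros w Hw.
assert (H1 := Rlt_le_trans _ _ _ Hw (Rmin_l _ _)).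
assert (H2 := Rlt_le_trans _ _ _ Hw (Rmin_r _ _)).
assert (Hwm : m / 2 < Cmod w).
{ assert (T := Cmod_triangle (z - w)%C w). replace (z - w + w)%C with z in T by ring.
  fold m in T. rewrite <- Cmod_opp in T. replace (- (z - w))%C with (w - z)%C in T by ring.
  lra. }
assert (Hw0 : w <> RtoC 0) by (apply Cmod_gt_0; lra).
replace (/ w - / z - (w - z) * - / (z * z))%C with ((w - z) * (w - z) * / (w * (z * z)))%C.
2:{ field. auto. }
rewrite !Cmod_mult, Cmod_inv, !Cmod_mult.
fold m. 2:{ repeat apply Cmult_neq_0; auto. }
set (d := Cmod (w - z)%C) in *.
assert (Hd : 0 <= d) by apply Cmod_ge_0.
rewrite (Rmult_comm eps). rewrite Rmult_assoc. apply Rmult_le_compat_l; auto.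
apply Rmult_le_reg_r with (Cmod w * (m * m)). apply Rmult_lt_0_compat; nra.
rewrite Rmult_assoc, Rinv_l by (apply Rgt_not_eq, Rmult_lt_0_compat; nra).
assert (eps * (m / 2) * (m * m) <= eps * (Cmod w * (m * m))).
{ rewrite Rmult_assoc. apply Rmult_le_compat_l; [lra|]. apply Rmult_le_compat_r; nra. }
lra.
Qed.

Lemma Ccont_AbsRing (f : R -> C) (t : R) :
  Ccont f t <-> @continuous R_UniformSpace (AbsRing_UniformSpace C_AbsRing) f t.
Proof.
split; intros H P HP.
- exact (H P (proj2 (locally_C _ _) HP)).
- exact (H P (proj1 (locally_C _ _) HP)).
Qed.

Lemma Ccont_mult (f g : R -> C) (t : R) : Ccont f t -> Ccont g t -> Ccont (fun s => f s * g
  s)%C t.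
Proof.
intros Hf Hg. apply Ccont_AbsRing in Hf, Hg. apply Ccont_AbsRing.
exact (@continuous_mult R_UniformSpace C_AbsRing f g t Hf Hg).
Qed.

Lemma Ccont_const (c : C) (t : R) : Ccont (fun _ => c) t.
Proof. apply continuous_const. Qed.

Lemma Ccont_minus (f g : R -> C) (t : R) : Ccont f t -> Ccont g t -> Ccont (fun s => f s - g
  s)%C t.
Proof. apply (@continuous_minus R_UniformSpace R_AbsRing C_R_NormedModule). Qed.

Lemma Ccont_inv (f : R -> C) (t : R) : Ccont f t -> f t <> RtoC 0 -> Ccont (fun s => / f s)%C t.
Proof.
intros Hf H0. apply (Ccont_path Cinv); auto. apply Cdiff_cont.
eexists. now apply Cder_inv.
Qed.

Lemma Ccont_pow (f : R -> C) (t : R) (n : nat) : Ccont f t -> Ccont (fun s => f s ^ n)%C t.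
Proof.
intros Hf. induction n. apply Ccont_const. now apply Ccont_mult.
Qed.

(** The integral lives in a real module, so a complex factor is treated through the two real
    components, which it mixes. *)
Lemma is_CInt_scal (f : R -> C) (a b : R) (c l : C) :
  is_CInt f a b l -> is_CInt (fun t => c * f t)%C a b (c * l)%C.
Proof.
intros H.
assert (H1 := is_RInt_fct_extend_fst (U:=R_NormedModule) (V:=R_NormedModule) f a b l H).
assert (H2 := is_RInt_fct_extend_snd (U:=R_NormedModule) (V:=R_NormedModule) f a b l H).
apply (is_RInt_fct_extend_pair (U:=R_NormedModule) (V:=R_NormedModule)).
- exact (is_RInt_minus _ _ _ _ _ _ (is_RInt_scal _ _ _ (fst c) _ H1) (is_RInt_scal _ _ _ (snd
  c) _ H2)).
- exact (is_RInt_plus _ _ _ _ _ _ (is_RInt_scal _ _ _ (fst c) _ H2) (is_RInt_scal _ _ _ (snd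
  c) _ H1)).
Qed.

(** * Circles and the integrals over them *)

Definition eit (t : R) : C := (cos t, sin t).
Definition circ (z0 : C) (r t : R) : C := (z0 + RtoC r * eit t)%C.

Lemma Cmod_eit (t : R) : Cmod (eit t) = 1.
Proof.
unfold Cmod, eit; simpl. rewrite !Rmult_1_r.
replace (cos t * cos t + sin t * sin t) with 1. apply sqrt_1.
generalize (sin2_cos2 t). unfold Rsqr; lra.
Qed.

Lemma Pder_circ (z0 : C) (r t : R) : Pder (circ z0 r) t (Ci * (RtoC r * eit t))%C.
Proof.
replace (Ci * (RtoC r * eit t))%C with ((r * - sin t, r * cos t) : C).
2:{ apply injective_projections; simpl; ring. }
apply (@is_derive_ext R_AbsRing C_R_NormedModule (fun t => (fst z0 + r * cos t,
snd z0 + r * sin t))).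
{ intros s. apply injective_projections; simpl; ring. }
apply Pder_pair; auto_derive; auto; ring.
Qed.

Lemma circ_dist (z0 : C) (r t : R) : 0 < r -> Cmod (circ z0 r t - z0)%C = r.
Proof.
intros Hr. unfold circ. replace (z0 + r * eit t - z0)%C with (RtoC r * eit t)%C by ring.
rewrite Cmod_mult, Cmod_eit, Cmod_R, Rabs_pos_eq; lra.
Qed.

Lemma circ_far (z0 z : C) (r t : R) : 0 < r ->
  r - Cmod (z - z0)%C <= Cmod (circ z0 r t - z)%C.
Proof.
intros Hr. rewrite <- (circ_dist z0 r t) at 1 by auto.
assert (T := Cmod_triangle (circ z0 r t - z)%C (z - z0)%C).
replace (circ z0 r t - z + (z - z0))%C with (circ z0 r t - z0)%C in T by ring. lra.
Qed.

Lemma Cmod_lt_Sq (z0 z : C) (r : R) : Cmod (z - z0)%C < r -> Sq z0 r z.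
Proof.
intros H. assert (M := Rmax_Cmod (z - z0)%C). simpl in M.
split; eapply Rle_lt_trans; [eapply Rle_trans; [apply Rmax_l|exact M]|exact H|
  eapply Rle_trans; [apply Rmax_r|exact M]|exact H].
Qed.

Lemma circ_2PI (z0 : C) (r : R) : circ z0 r (2 * PI) = circ z0 r 0.
Proof. unfold circ, eit. now rewrite cos_2PI, sin_2PI, cos_0, sin_0. Qed.

Lemma Ccont_circ (z0 : C) (r t : R) : Ccont (circ z0 r) t.
Proof. eapply Pder_cont, Pder_circ. Qed.

(** The derivative of [circ z0 r], whatever the centre: the dz of circle integrals. *)
Definition dcirc (r t : R) : C := (Ci * (RtoC r * eit t))%C.

Lemma Ccont_dcirc (r t : R) : Ccont (dcirc r) t.
Proof.
unfold dcirc. apply Ccont_mult_const.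
apply continuous_ext with (f := circ (RtoC 0) r).
intros s. unfold circ. apply injective_projections; simpl; ring.
apply Ccont_circ.
Qed.

Lemma is_CInt_ext (f g : R -> C) (a b : R) (l : C) :
  (forall t, f t = g t) -> is_CInt f a b l -> is_CInt g a b l.
Proof. intros H. apply (@is_RInt_ext C_R_NormedModule). auto. Qed.

Lemma is_CInt_circ_primitive (P G : C -> C) (z0 : C) (r : R) :
  (forall t, Cder P (circ z0 r t) (G (circ z0 r t))) ->
  (forall t, Ccont_at G (circ z0 r t)) ->
  is_CInt (fun t => dcirc r t * G (circ z0 r t))%C 0 (2 * PI) (RtoC 0).
Proof.
intros HP HG.
replace (RtoC 0) with (P (circ z0 r (2 * PI)) - P (circ z0 r 0%R))%C.
2:{ rewrite circ_2PI. ring. }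
apply is_CInt_path. intros t _. split; [apply Pder_circ|]. split; [apply HP|].
apply Ccont_mult. apply Ccont_dcirc.
apply (Ccont_path G); auto. apply Ccont_circ.
Qed.

(** Meant for [A = 1 / (u - w)], [B = 1 / (u - z)], [h = w - z]: it is the first-order expansion of
    [1 / (u - z)^n] in [z]. As [K] depends only on [M] and [n], the quadratic remainder is uniform
    in [u] on the circle, which permits differentiation under the integral. *)
Lemma inv_pow_bound (M : R) (n : nat) : 0 <= M -> exists K : R, 0 <= K /\
  forall A B h : C, (A - B = h * A * B)%C -> Cmod A <= M -> Cmod B <= M -> Cmod h <= 1 ->
  Cmod (A ^ n - B ^ n - RtoC (INR n) * h * B ^ S n)%C <= K * (Cmod h * Cmod h).
Proof.
intros HM. induction n as [|n (K & HK & IH)].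
- exists 0. split; [lra|]. intros A B h _ _ _ _. simpl.
  match goal with |- Cmod ?e <= _ => replace e with (RtoC 0) by ring end.
  rewrite Cmod_0. lra.
(* The three summands are the bounds [T1], [T3] and [T4]. *)
- exists (M ^ n * M ^ 3 + M ^ 2 * (K + INR n * M ^ S n) + M * K).
  assert (Hn := pos_INR n).
  assert (P0 : 0 <= M ^ n) by now apply pow_le.
  assert (P1 : 0 <= M ^ S n) by now apply pow_le.
  assert (P2 : 0 <= M ^ 2) by now apply pow_le.
  assert (P3 : 0 <= M ^ 3) by now apply pow_le.
  assert (Q0 := Rmult_le_pos _ _ Hn P1).
  split.
  { assert (Q1 := Rmult_le_pos _ _ P0 P3). assert (Q2 := Rmult_le_pos _ _ HM HK).
    assert (Q3 : 0 <= M ^ 2 * (K + INR n * M ^ S n)) by (apply Rmult_le_pos; lra). lra. }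
  intros A B h E HA HB Hh.
  specialize (IH A B h E HA HB Hh).
  set (En := (A ^ n - B ^ n - RtoC (INR n) * h * B ^ S n)%C) in *.
  set (d := Cmod h) in *. assert (Hd : 0 <= d) by apply Cmod_ge_0.
  assert (PA : Cmod (A ^ n)%C <= M ^ n).
  { rewrite Cmod_pow. apply pow_incr. split; auto. apply Cmod_ge_0. }
  assert (PB : Cmod (B ^ S n)%C <= M ^ S n).
  { rewrite Cmod_pow. apply pow_incr. split; auto. apply Cmod_ge_0. }
  (* Inserting the hypothesis into itself gives [A = B + h B^2 + h^2 A B^2]; one factor of [A ^ S n]
     is expanded in this way. *)
  replace (A ^ S n - B ^ S n - RtoC (INR (S n)) * h * B ^ S (S n))%C with
    (A ^ n * (h * h * A * B * B) + h * B * B * (En + RtoC (INR n) * h * B ^ S n) + B * En)%C.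
  2:{ rewrite S_INR, RtoC_plus. unfold En. simpl Cpow.
      replace (h * h * A * B * B)%C with (A - B - h * B * B)%C.
      ring.
      transitivity (h * A * B - h * B * B)%C; [now rewrite E|].
      transitivity (h * B * (A - B))%C; [ring|]. rewrite E. ring. }
  assert (Hmono : forall x y a b, 0 <= x -> 0 <= y -> x <= a -> y <= b -> x * y <= a * b)
    by (intros; apply Rmult_le_compat; auto).
  assert (CA := Cmod_ge_0 A). assert (CB := Cmod_ge_0 B).
  assert (T1 : Cmod (A ^ n * (h * h * A * B * B))%C <= M ^ n * M ^ 3 * (d * d)).
  { rewrite !Cmod_mult. fold d.
    replace (M ^ n * M ^ 3 * (d * d)) with (M ^ n * (d * d * M * M * M)) by (simpl; ring).
    apply Hmono; auto. apply Cmod_ge_0. repeat apply Rmult_le_pos; auto.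
    repeat apply Hmono; repeat apply Rmult_le_pos; auto; lra. }
  assert (T2 : Cmod (En + RtoC (INR n) * h * B ^ S n)%C <= (K + INR n * M ^ S n) * d).
  { eapply Rle_trans; [apply Cmod_triangle|]. rewrite !Cmod_mult, Cmod_R, Rabs_pos_eq by auto.
    fold d. assert (K * (d * d) <= K * d) by (apply Rmult_le_compat_l; nra).
    assert (INR n * d * Cmod (B ^ S n)%C <= INR n * d * M ^ S n).
    { apply Rmult_le_compat_l; auto. now apply Rmult_le_pos. }
    lra. }
  assert (T3 : Cmod (h * B * B * (En + RtoC (INR n) * h * B ^ S n))%C <= M ^ 2 * (K + INR n *
  M ^ S n) * (d * d)).
  { rewrite Cmod_mult, !Cmod_mult with (y := B). fold d.
    replace (M ^ 2 * (K + INR n * M ^ S n) * (d * d)) with ((d * M * M) * ((K + INR n * M ^ S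
    n) * d)) by (simpl; ring).
    apply Hmono; auto. repeat apply Rmult_le_pos; auto. apply Cmod_ge_0.
    repeat apply Hmono; repeat apply Rmult_le_pos; auto; lra. }
  assert (T4 : Cmod (B * En)%C <= M * K * (d * d)).
  { rewrite Cmod_mult. rewrite Rmult_assoc. apply Hmono; auto. apply Cmod_ge_0. }
  eapply Rle_trans; [apply Cmod_triangle|].
  eapply Rle_trans; [apply Rplus_le_compat_r, Cmod_triangle|]. lra.
Qed.

(** Cauchy-type integral of a density [phi]; the factor dz/dt, when wanted, is part of [phi]. *)
Definition Kint (z0 : C) (r : R) (phi : R -> C) (n : nat) (z : C) : C :=
  CInt (fun t => phi t * (/ (circ z0 r t - z)) ^ n)%C 0 (2 * PI).

Lemma circ_neq (z0 z : C) (r t : R) : 0 < r -> Cmod (z - z0)%C < r ->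
  (circ z0 r t - z)%C <> RtoC 0.
Proof.
intros Hr Hz. apply Cmod_gt_0. generalize (circ_far z0 z r t Hr). lra.
Qed.

Lemma is_Kint (z0 : C) (r : R) (phi : R -> C) (n : nat) (z : C) :
  0 < r -> (forall t, Ccont phi t) -> Cmod (z - z0)%C < r ->
  is_CInt (fun t => phi t * (/ (circ z0 r t - z)) ^ n)%C 0 (2 * PI) (Kint z0 r phi n z).
Proof.
intros Hr Hphi Hz. apply Ccont_CInt. intros t _.
apply Ccont_mult; auto. apply Ccont_pow. apply Ccont_inv; [|now apply circ_neq].
apply Ccont_minus. apply Ccont_circ. apply Ccont_const.
Qed.

Lemma Ccont_bounded (f : R -> C) (a b : R) : a <= b -> (forall t, Ccont f t) ->
  exists M, 0 <= M /\ forall t, a <= t <= b -> Cmod (f t) <= M.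
Proof.
intros Hab Hf.
destruct (continuity_ab_maj (fun t => Cmod (f t)) a b Hab) as (m & Hm & _).
{ intros c _. apply continuity_pt_filterlim.
  assert (N := continuous_comp f (@norm R_AbsRing C_R_NormedModule) c (Hf c)).
  apply (continuous_ext (fun t => @norm R_AbsRing C_R_NormedModule (f t))).
  intros t; symmetry; apply Cmod_norm.
  apply N. apply (@filterlim_norm R_AbsRing C_R_NormedModule). }
exists (Cmod (f m)). split. apply Cmod_ge_0. exact Hm.
Qed.

(** Differentiation under the integral sign, with the remainder controlled by [inv_pow_bound]. It
    applies to every continuous density, so it yields derivatives of all orders. *)
Lemma Cder_Kint (z0 : C) (r : R) (phi : R -> C) (n : nat) (z : C) :
  0 < r -> (forall t, Ccont phi t) -> Cmod (z - z0)%C < r ->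
  Cder (Kint z0 r phi n) z (RtoC (INR n) * Kint z0 r phi (S n) z)%C.
Proof.
intros Hr Hphi Hz.
assert (PI0 := PI_RGT_0).
destruct (Ccont_bounded phi 0 (2 * PI)) as (Mp & HMp & Bp); auto; [lra|].
(* The circle is at distance at least [d] from [z]. Points closer than [d / 2] to [z] stay more than
   [d / 2] away from it, whence the bound [2 / d] for both inverses. *)
set (d := r - Cmod (z - z0)%C) in *. assert (Hd : 0 < d) by (unfold d; lra).
assert (HM : 0 <= 2 / d) by (left; apply Rdiv_lt_0_compat; lra).
destruct (inv_pow_bound (2 / d) n HM) as (K & HK & HB).
apply Cder_eps. intros eps He.
set (D := 2 * PI * Mp * K + 1).
assert (HD0 : 0 <= 2 * PI * Mp * K).
{ apply Rmult_le_pos; auto. apply Rmult_le_pos; lra. }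
assert (HD : 0 < D) by (unfold D; lra).
exists (Rmin 1 (Rmin (d / 2) (eps / D))). split.
{ repeat apply Rmin_pos; try lra. now apply Rdiv_lt_0_compat. }
intros w Hw.
assert (H1 := Rlt_le_trans _ _ _ Hw (Rmin_l _ _)).
assert (H2 := Rlt_le_trans _ _ _ Hw (Rle_trans _ _ _ (Rmin_r _ _) (Rmin_l _ _))).
assert (H3 := Rlt_le_trans _ _ _ Hw (Rle_trans _ _ _ (Rmin_r _ _) (Rmin_r _ _))).
set (h := (w - z)%C) in *.
assert (Hw0 : Cmod (w - z0)%C <= Cmod h + Cmod (z - z0)%C).
{ replace (w - z0)%C with (h + (z - z0))%C by (unfold h; ring). apply Cmod_triangle. }
assert (Hwr : Cmod (w - z0)%C < r) by (unfold d in *; lra).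
assert (I : is_CInt (fun t => phi t * ((/ (circ z0 r t - w)) ^ n - (/ (circ z0 r t - z)) ^ n
     - RtoC (INR n) * h * (/ (circ z0 r t - z)) ^ S n))%C 0 (2 * PI)
   (Kint z0 r phi n w - Kint z0 r phi n z - h * RtoC (INR n) * Kint z0 r phi (S n) z)%C).
{ eapply is_CInt_ext; [|apply is_CInt_minus; [apply is_CInt_minus|apply is_CInt_scal];
  apply is_Kint; auto].
  intros t. simpl. ring. }
replace (h * (RtoC (INR n) * Kint z0 r phi (S n) z))%C with (h * RtoC (INR n) * Kint z0 r phi
(S n) z)%C by ring.
eapply Rle_trans.
{ apply (is_CInt_bound _ 0 (2 * PI) (Mp * (K * (Cmod h * Cmod h)))) in I; [exact I|].
  intros t Ht. apply between_le in Ht; [|lra].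
  rewrite Cmod_mult. apply Rmult_le_compat; try apply Cmod_ge_0. now apply Bp.
  assert (Hinv : forall x, Cmod (x - z0)%C < r - d / 2 -> Cmod (/ (circ z0 r t - x))%C <= 2 /
  d).
  { intros x Hx. assert (F := circ_far z0 x r t Hr).
    rewrite Cmod_inv by (apply circ_neq; lra).
    replace (2 / d) with (/ (d / 2)) by (field; lra).
    apply Rinv_le_contravar; lra. }
  apply HB.
  - unfold h. field. split; apply circ_neq; auto.
  - apply Hinv. unfold d in *; lra.
  - apply Hinv. unfold d in *; lra.
  - lra. }
rewrite Rminus_0_r, (Rabs_pos_eq (2 * PI)) by lra.
assert (Hh := Cmod_ge_0 h).
apply Rle_trans with (D * (eps / D) * Cmod h).
2: right; field; lra.
replace (2 * PI * (Mp * (K * (Cmod h * Cmod h)))) with (2 * PI * Mp * K * Cmod h * Cmod h) by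
ring.
apply Rmult_le_compat_r; auto.
apply Rmult_le_compat; auto; unfold D in *; lra.
Qed.

(** * Cauchy's formula and the identity principle *)

Lemma circ_Sq (z0 : C) (r R0 t : R) : 0 < r < R0 -> Sq z0 R0 (circ z0 r t).
Proof. intros H. apply Cmod_lt_Sq. rewrite circ_dist; lra. Qed.

Lemma Cdiff_sub_inv (F : C -> C) (c p z : C) : Cdiff_at F z -> z <> p ->
  Cdiff_at (fun w => (F w - c) * / (w - p))%C z.
Proof.
intros [l Hl] Hz.
assert (Hz' : (z - p)%C <> RtoC 0).
{ intros E. apply Hz. replace z with ((z - p) + p)%C by ring. rewrite E. ring. }
eexists. apply Cder_mult.
- apply Cder_minus; [exact Hl|apply Cder_const].
- apply (Cder_comp Cinv (fun w => w - p)%C). now apply Cder_inv.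
  apply Cder_minus; [apply Cder_id|apply Cder_const].
Qed.

Lemma Cdiff_at_ext_near (F G : C -> C) (z : C) (d : R) : 0 < d ->
  (forall w, Cmod (w - z)%C < d -> F w = G w) -> Cdiff_at F z -> Cdiff_at G z.
Proof. intros Hd E [l Hl]. exists l. exact (Cder_ext_near F G z l d Hd E Hl). Qed.

Lemma C_sub_neq0 (z w : C) : z <> w -> (z - w)%C <> RtoC 0.
Proof.
intros H E. apply H. replace z with ((z - w) + w)%C by ring. rewrite E. ring.
Qed.

(** The quotient, completed at [z], has a primitive by [primitive_exists] with exceptional point
    [z], and a circle is a closed path. *)
Lemma is_CInt_quotient (G : C -> C) (z0 z : C) (r R0 : R) :
  holomorphic_on (Sq z0 R0) G -> 0 < r < R0 -> Cmod (z - z0)%C < r ->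
  is_CInt (fun t => dcirc r t * ((G (circ z0 r t) - G z) * / (circ z0 r t - z)))%C
    0 (2 * PI) (RtoC 0).
Proof.
intros HG Hr Hz.
assert (Hzs : Sq z0 R0 z) by (apply Cmod_lt_Sq; lra).
destruct (HG z Hzs) as [l Hl].
(* The value [l = G'(z)] at [z] makes [q] continuous there. *)
set (q := fun w => if excluded_middle_informative (w = z) then l
                   else ((G w - G z) * / (w - z))%C).
assert (qE : forall w, w <> z -> q w = ((G w - G z) * / (w - z))%C).
{ intros w Hw. unfold q. destruct excluded_middle_informative; tauto. }
assert (qz : q z = l).
{ unfold q. destruct excluded_middle_informative; tauto. }
assert (qd : forall w, Sq z0 R0 w -> w <> z -> Cdiff_at q w).
{ intros w Hw Hne.
  apply (Cdiff_at_ext_near (fun w => (G w - G z) * / (w - z))%C q w (Cmod (w - z)%C)).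
  - apply Cmod_gt_0. now apply C_sub_neq0.
  - intros v Hv. symmetry. apply qE. intros ->.
    replace (z - w)%C with (- (w - z))%C in Hv by ring. rewrite Cmod_opp in Hv. lra.
  - apply Cdiff_sub_inv; auto. }
assert (qc : forall w, Sq z0 R0 w -> Ccont_at q w).
{ intros w Hw. destruct (excluded_middle_informative (w = z)) as [->|Hne].
  2: now apply Cdiff_cont, qd.
  intros eps He. destruct (proj1 (Cder_eps _ _ _) Hl (eps / 2)) as (d & Hd & H); [lra|].
  exists d; split; auto. intros w Hw'. rewrite qz.
  destruct (excluded_middle_informative (w = z)) as [->|Hne].
  { rewrite qz. replace (l - l)%C with (RtoC 0) by ring. rewrite Cmod_0; lra. }
  rewrite qE by auto.
  assert (N := C_sub_neq0 _ _ Hne). assert (NP := proj1 (Cmod_gt_0 _) N).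
  replace ((G w - G z) * / (w - z) - l)%C with ((G w - G z - (w - z) * l) * / (w - z))%C.
  2:{ field; auto. }
  rewrite Cmod_mult, Cmod_inv by auto.
  apply Rle_lt_trans with (eps / 2 * Cmod (w - z)%C * / Cmod (w - z)%C).
  apply Rmult_le_compat_r. left; now apply Rinv_0_lt_compat. now apply H.
  rewrite Rmult_assoc, Rinv_r by lra. lra. }
destruct (primitive_exists q z0 z R0 Hzs qc qd) as [Q HQ].
eapply is_CInt_ext; [|apply (is_CInt_circ_primitive Q q z0 r)].
- intros t. simpl. rewrite qE; auto. intros E.
  apply (circ_neq z0 z r t); try lra. rewrite E. ring.
- intros t. now apply HQ, circ_Sq.
- intros t. now apply qc, circ_Sq.
Qed.

Lemma Cpow_1 (z : C) : (z ^ 1)%C = z.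
Proof. simpl. ring. Qed.

(** At the centre the integrand is constantly [Ci]. *)
Lemma Kint_dcirc_center (z0 : C) (r : R) : 0 < r ->
  Kint z0 r (dcirc r) 1 z0 = (RtoC (2 * PI) * Ci)%C.
Proof.
intros Hr. apply is_CInt_unique.
apply (is_CInt_ext (fun _ => Ci)).
{ intros t. unfold dcirc, circ. rewrite Cpow_1.
  replace (z0 + r * eit t - z0)%C with (r * eit t)%C by ring.
  field. split.
  apply Cmod_gt_0. rewrite Cmod_eit. lra.
  intros E; apply RtoC_inj in E; lra. }
replace (RtoC (2 * PI) * Ci)%C with (@scal R_AbsRing C_R_NormedModule (2 * PI - 0) Ci).
apply (@is_RInt_const C_R_NormedModule).
apply injective_projections; simpl; unfold scal; simpl; unfold mult; simpl; ring.
Qed.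

(** [- 1 / (w - z)] is a primitive along the whole circle. *)
Lemma Kint_dcirc_2 (z0 z : C) (r : R) : 0 < r -> Cmod (z - z0)%C < r ->
  Kint z0 r (dcirc r) 2 z = RtoC 0.
Proof.
intros Hr Hz. apply is_CInt_unique.
apply (is_CInt_circ_primitive (fun w => - / (w - z))%C (fun w => (/ (w - z)) ^ 2)%C).
- intros t. assert (N := circ_neq z0 z r t Hr Hz).
  eapply Cder_ext_near with (F := fun w => ((- RtoC 1) * / (w - z))%C) (d := 1); [lra| |].
  intros w _. simpl. ring.
  replace ((/ (circ z0 r t - z)) ^ 2)%C with
    (- RtoC 1 * (- / ((circ z0 r t - z) * (circ z0 r t - z)) * (RtoC 1 - RtoC 0)))%C.
  2:{ simpl. field. auto. }
  apply Cder_scal. apply (Cder_comp Cinv (fun w => w - z)%C).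
  now apply Cder_inv. apply Cder_minus; [apply Cder_id|apply Cder_const].
- intros t. assert (N := circ_neq z0 z r t Hr Hz).
  apply Cdiff_cont. eexists.
  eapply Cder_ext_near with (F := fun w => (/ (w - z) * / (w - z))%C) (d := 1); [lra| |].
  intros w _. simpl. ring.
  apply Cder_mult; (apply (Cder_comp Cinv (fun w => w - z)%C);
  [now apply Cder_inv| apply Cder_minus; [apply Cder_id|apply Cder_const]]).
Qed.

(** The derivative in [z] is [Kint] with exponent 2, which vanishes; hence the integral is constant
    on the segment [g] from [z0] to [z], and its value at [z0] is known. *)
Lemma Kint_dcirc_1 (z0 z : C) (r : R) : 0 < r -> Cmod (z - z0)%C < r ->
  Kint z0 r (dcirc r) 1 z = (RtoC (2 * PI) * Ci)%C.
Proof.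
intros Hr Hz. rewrite <- (Kint_dcirc_center z0 r Hr).
set (g := fun t : R => (z0 + RtoC t * (z - z0))%C).
assert (Hg : forall t, Pder g t (z - z0)%C).
{ intros t. apply Pder_eps. intros eps He. exists 1; split; [lra|]. intros s _.
  unfold g. replace (z0 + s * (z - z0) - (z0 + t * (z - z0)) - (s - t)%R * (z - z0))%C with
  (RtoC 0).
  rewrite Cmod_0. apply Rmult_le_pos; [lra|apply Rabs_pos].
  rewrite RtoC_minus. ring. }
assert (Hg1 : forall t, 0 <= t <= 1 -> Cmod (g t - z0)%C < r).
{ intros t Ht. unfold g. replace (z0 + t * (z - z0) - z0)%C with (RtoC t * (z - z0))%C by ring.
  rewrite Cmod_mult, Cmod_R, Rabs_pos_eq by lra.
  generalize (Cmod_ge_0 (z - z0)%C). nra. }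
symmetry.
replace z0 with (g 0) at 2 by (unfold g; ring). replace z with (g 1) by (unfold g; ring).
apply (@eq_is_derive C_R_NormedModule (fun t => Kint z0 r (dcirc r) 1 (g t)) 0 1); [|lra].
intros t Ht.
replace (@zero C_R_NormedModule) with ((z - z0) * RtoC 0)%C by exact (Cmult_0_r _).
apply Pder_comp; auto.
replace (RtoC 0) with (RtoC (INR 1) * Kint z0 r (dcirc r) 2 (g t))%C.
apply Cder_Kint; auto. apply Ccont_dcirc.
rewrite Kint_dcirc_2; auto. ring.
Qed.

Lemma Ccont_circ_comp (G : C -> C) (z0 : C) (r R0 : R) : holomorphic_on (Sq z0 R0) G -> 0 < r
  < R0 ->
  forall t, Ccont (fun t => G (circ z0 r t)) t.
Proof.
intros HG Hr t. apply (Ccont_path G (circ z0 r)). apply Cdiff_cont, HG. now apply circ_Sq.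
apply Ccont_circ.
Qed.

(** On the circle write [G] as [(G - G z) + G z]: the first part integrates to zero by
    [is_CInt_quotient], the second gives [G z] times [Kint_dcirc_1]. *)
Lemma Cauchy_formula (G : C -> C) (z0 z : C) (r R0 : R) :
  holomorphic_on (Sq z0 R0) G -> 0 < r < R0 -> Cmod (z - z0)%C < r ->
  Kint z0 r (fun t => dcirc r t * G (circ z0 r t))%C 1 z = (RtoC (2 * PI) * Ci * G z)%C.
Proof.
intros HG Hr Hz.
assert (E1 := is_CInt_quotient G z0 z r R0 HG Hr Hz).
assert (E2 := is_Kint z0 r (dcirc r) 1 z (proj1 Hr) (Ccont_dcirc r) Hz).
rewrite Kint_dcirc_1 in E2; auto; [|lra].
apply (is_CInt_scal _ _ _ (G z)) in E2.
assert (E3 := @is_RInt_plus C_R_NormedModule _ _ _ _ _ _ E1 E2).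
apply is_CInt_unique.
assert (E4 : (RtoC 0 + G z * (RtoC (2 * PI) * Ci))%C = (RtoC (2 * PI) * Ci * G z)%C) by ring.
rewrite <- E4.
eapply is_CInt_ext; [|exact E3].
intros t.
assert (E5 : (dcirc r t * ((G (circ z0 r t) - G z) * / (circ z0 r t - z)) + G z * (dcirc r t
* (/ (circ z0 r t - z))^1))%C
 = (dcirc r t * G (circ z0 r t) * (/ (circ z0 r t - z))^1)%C) by (rewrite Cpow_1; ring).
exact E5.
Qed.

Lemma twoPIi_neq0 : (RtoC (2 * PI) * Ci)%C <> RtoC 0.
Proof.
apply Cmult_neq_0. intros E; apply RtoC_inj in E. generalize PI_RGT_0; lra.
apply Cmod_gt_0. rewrite Cmod_Ci; lra.
Qed.

(** Near [z0], [G] is a constant times [Kint] with exponent 1, so its derivative is the same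
    constant times [Kint] with exponent 2, which [Cder_Kint] differentiates again. *)
Lemma C_derive_Cdiff (G : C -> C) (z0 : C) (R0 : R) : 0 < R0 ->
  holomorphic_on (Sq z0 R0) G -> Cdiff_at (C_derive G) z0.
Proof.
intros HR HG.
set (r := R0 / 2). assert (Hr : 0 < r < R0) by (unfold r; lra).
set (phi := fun t => (dcirc r t * G (circ z0 r t))%C).
assert (Hphi : forall t, Ccont phi t).
{ intros t. apply Ccont_mult. apply Ccont_dcirc. now apply (Ccont_circ_comp G z0 r R0). }
set (c := (/ (RtoC (2 * PI) * Ci))%C).
assert (E : forall z, Cmod (z - z0)%C < r -> (c * Kint z0 r phi 1 z)%C = G z).
{ intros z Hz. unfold phi. rewrite (Cauchy_formula G z0 z r R0) by auto.
  unfold c. rewrite Cmult_assoc, Cinv_l. ring. apply twoPIi_neq0. }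
assert (D : forall z, Cmod (z - z0)%C < r -> C_derive G z = (c * Kint z0 r phi 2 z)%C).
{ intros z Hz. apply is_C_derive_unique.
  apply (Cder_ext_near (fun z => c * Kint z0 r phi 1 z)%C G z _ (r - Cmod (z - z0)%C));
  [lra| |].
  - intros w Hw. apply E. replace (w - z0)%C with ((w - z) + (z - z0))%C by ring.
    eapply Rle_lt_trans; [apply Cmod_triangle|]. lra.
  - apply Cder_scal. replace (Kint z0 r phi 2 z) with (RtoC (INR 1) * Kint z0 r phi 2 z)%C by
    (simpl; ring).
    apply Cder_Kint; auto; lra. }
apply (Cdiff_at_ext_near (fun z => c * Kint z0 r phi 2 z)%C _ z0 r); [lra| |].
- intros w Hw. symmetry; auto.
- eexists. apply Cder_scal. apply Cder_Kint; auto; try lra.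
  replace (z0 - z0)%C with (RtoC 0) by ring. rewrite Cmod_0; lra.
Qed.

(* With [Rn n z] the integral of [G w / ((w - z0)^n (w - z))] over a circle, one
   has [Rn n z = Rn n z0 + (z - z0) Rn (n+1) z]; so every [Rn n] vanishes on the
   real segment, and [Rn 0 z = (z - z0)^n Rn n z] tends to [0] with [n]. *)
Lemma identity_principle (G : C -> C) (z0 z : C) (R0 rho : R) :
  holomorphic_on (Sq z0 R0) G -> 0 < rho ->
  (forall s : R, Rabs s < rho -> G (z0 + RtoC s)%C = RtoC 0) ->
  Cmod (z - z0)%C < R0 -> G z = RtoC 0.
Proof.
intros HG Hrho H0 Hz.
set (r := (Cmod (z - z0)%C + R0) / 2).
assert (Hz0 := Cmod_ge_0 (z - z0)%C).
assert (Hr : 0 < r < R0) by (unfold r; lra).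
assert (Hzr : Cmod (z - z0)%C < r) by (unfold r; lra).
set (psi := fun t => (dcirc r t * G (circ z0 r t))%C).
assert (Hpsi : forall t, Ccont psi t).
{ intros t. apply Ccont_mult. apply Ccont_dcirc. now apply (Ccont_circ_comp G z0 r R0). }
(* The power of [1 / (w - z0)] is put into the density, so that each [Rn n] is a [Kint] with
   exponent 1 and therefore continuous by [Cder_Kint]. *)
set (phi := fun n t => (psi t * (/ (circ z0 r t - z0)) ^ n)%C).
assert (Hc0 : Cmod (z0 - z0)%C < r).
{ replace (z0 - z0)%C with (RtoC 0) by ring. rewrite Cmod_0; lra. }
assert (Hphi : forall n t, Ccont (phi n) t).
{ intros n t. apply Ccont_mult; auto. apply Ccont_pow, Ccont_inv.
  apply Ccont_minus. apply Ccont_circ. apply Ccont_const. apply circ_neq; lra. }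
set (Rn := fun n w => Kint z0 r (phi n) 1 w).
(* Partial fractions: [1/(u - w) - 1/(u - z0) = (w - z0) / ((u - w)(u - z0))]. *)
assert (Rec : forall n w, Cmod (w - z0)%C < r -> Rn n w = (Rn n z0 + (w - z0) * Rn (S n) w)%C).
{ intros n w Hw.
  assert (I1 := is_Kint z0 r (phi n) 1 w (proj1 Hr) (Hphi n) Hw).
  assert (I2 := is_Kint z0 r (phi n) 1 z0 (proj1 Hr) (Hphi n) Hc0).
  assert (I3 := is_CInt_scal _ _ _ (w - z0)%C _ (is_Kint z0 r (phi (S n)) 1 w (proj1 Hr)
  (Hphi (S n)) Hw)).
  assert (I4 := is_CInt_minus _ _ _ _ _ _ I1 I2).
  assert (E : (Rn n w - Rn n z0)%C = ((w - z0) * Rn (S n) w)%C).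
  { apply is_CInt_unique in I3. unfold Rn. rewrite <- I3. symmetry. apply is_CInt_unique.
    eapply is_CInt_ext; [|exact I4].
    intros t. rewrite !Cpow_1. unfold phi.
    assert (N1 := circ_neq z0 w r t (proj1 Hr) Hw).
    assert (N2 := circ_neq z0 z0 r t (proj1 Hr) Hc0).
    simpl Cpow. set (X := ((/ (circ z0 r t - z0)) ^ n)%C). field. auto. }
  rewrite <- E. ring. }
assert (Z : forall n s, Rabs s < Rmin rho r -> Rn n (z0 + RtoC s)%C = RtoC 0).
{ assert (Hs0 : forall s, Rabs s < Rmin rho r -> Cmod (z0 + RtoC s - z0)%C < r).
  { intros s Hs. replace (z0 + s - z0)%C with (RtoC s) by ring. rewrite Cmod_R.
    eapply Rlt_le_trans; [exact Hs|apply Rmin_r]. }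
  assert (Hm : 0 < Rmin rho r) by (apply Rmin_pos; lra).
  induction n as [|n IH].
  - intros s Hs. unfold Rn.
    transitivity (Kint z0 r psi 1 (z0 + s)%C).
    { unfold Kint. f_equal. apply functional_extensionality. intros t. unfold phi. simpl.
      ring. }
    unfold psi. rewrite (Cauchy_formula G z0 _ r R0); auto.
    rewrite H0. ring. eapply Rlt_le_trans; [exact Hs|apply Rmin_l].
  (* For [s <> 0] the recursion is divided by [s]; the value at [s = 0] follows by continuity,
     tested at a small [s']. *)
  - assert (Zne : forall s, Rabs s < Rmin rho r -> s <> 0 -> Rn (S n) (z0 + RtoC s)%C = RtoC 0).
    { intros s Hs Hne. assert (K := Rec n _ (Hs0 s Hs)). rewrite IH in K by auto.
      assert (K0 := IH 0). rewrite Rabs_R0 in K0. specialize (K0 Hm).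
      replace (z0 + 0)%C with z0 in K0 by ring. rewrite K0 in K.
      replace (Rn (S n) (z0 + s)%C) with (/ RtoC s * (RtoC 0 + (z0 + s - z0) * Rn (S n) (z0 +
      s)))%C.
      rewrite <- K. ring. field. intros E; apply RtoC_inj in E; contradiction. }
    intros s Hs. destruct (Req_dec s 0) as [->|Hne]; [|now apply Zne].
    replace (z0 + 0)%C with z0 by ring.
    destruct (Req_dec (Cmod (Rn (S n) z0)) 0) as [E|E]; [now apply Cmod_eq_0|].
    assert (Ep : 0 < Cmod (Rn (S n) z0)) by (generalize (Cmod_ge_0 (Rn (S n) z0)); lra).
    destruct (Cder_continuous _ _ _ (Cder_Kint z0 r (phi (S n)) 1 z0 (proj1 Hr) (Hphi (S n))
    Hc0) _ Ep) as (d & Hd & K).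
    set (s' := Rmin d (Rmin rho r) / 2).
    assert (Hs' : 0 < s' /\ s' < d /\ s' < Rmin rho r).
    { assert (0 < Rmin d (Rmin rho r)) by now apply Rmin_pos.
      generalize (Rmin_l d (Rmin rho r)), (Rmin_r d (Rmin rho r)). unfold s'. lra. }
    exfalso. specialize (K (z0 + RtoC s')%C).
    fold (Rn (S n) (z0 + RtoC s')%C) (Rn (S n) z0) in K.
    rewrite (Zne s') in K; [| rewrite Rabs_pos_eq; lra | lra].
    replace (RtoC 0 - Rn (S n) z0)%C with (- Rn (S n) z0)%C in K by ring. rewrite Cmod_opp in K.
    assert (Cmod (z0 + s' - z0)%C < d).
    { replace (z0 + s' - z0)%C with (RtoC s') by ring. rewrite Cmod_R, Rabs_pos_eq; lra. }
    specialize (K H). lra. }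
assert (Z0 : forall n, Rn n z0 = RtoC 0).
{ intros n. replace z0 with (z0 + RtoC 0)%C at 1 by ring. apply Z. rewrite Rabs_R0.
  apply Rmin_pos; lra. }
assert (Pw : forall n, Rn 0%nat z = ((z - z0) ^ n * Rn n z)%C).
{ induction n. simpl; ring.
  rewrite IHn, (Rec n z Hzr), Z0. simpl. ring. }
assert (PI0 := PI_RGT_0).
destruct (Ccont_bounded psi 0 (2 * PI)) as (B & HB & Bpsi); auto; [lra|].
set (h := Cmod (z - z0)%C) in *.
(* On the circle [|u - z0| = r] and [|u - z| >= r - h]; [B] bounds [psi], which includes dz. *)
assert (Bd : forall n, Cmod (Rn n z) <= 2 * PI * (B * (/ r) ^ n * / (r - h))).
{ intros n.
  assert (I1 := is_Kint z0 r (phi n) 1 z (proj1 Hr) (Hphi n) Hzr).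
  apply (is_CInt_bound _ 0 (2 * PI) (B * (/ r) ^ n * / (r - h))) in I1.
  - rewrite Rminus_0_r, Rabs_pos_eq in I1 by lra. exact I1.
  - intros t Ht. apply between_le in Ht; [|lra]. rewrite Cpow_1. unfold phi.
    rewrite !Cmod_mult, Cmod_pow, !Cmod_inv by (apply circ_neq; lra || auto).
    rewrite circ_dist by lra.
    assert (Hir : 0 <= (/ r) ^ n) by (apply pow_le; left; apply Rinv_0_lt_compat; lra).
    assert (F := circ_far z0 z r t (proj1 Hr)). fold h in F.
    apply Rmult_le_compat.
    apply Rmult_le_pos; auto. apply Cmod_ge_0.
    left; apply Rinv_0_lt_compat; lra.
    apply Rmult_le_compat_r; auto.
    apply Rinv_le_contravar; lra. }
assert (Zero : Rn 0%nat z = RtoC 0).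
{ apply Cmod_eq_0, Rle_antisym; [|apply Cmod_ge_0].
  apply le_epsilon. intros e He. rewrite Rplus_0_l.
  set (K := 2 * PI * B * / (r - h)).
  assert (HK : 0 <= K).
  { apply Rmult_le_pos; [apply Rmult_le_pos; lra|]. left; apply Rinv_0_lt_compat; lra. }
  assert (Hir : 0 < / r) by (apply Rinv_0_lt_compat; lra).
  (* By [Pw] and [Bd], [Rn 0 z] is at most [K (h / r)^n], and [h < r]. *)
  destruct (pow_lt_1_zero (h * / r)) with (y := e / (K + 1)) as [n Hn].
  { rewrite Rabs_pos_eq by (apply Rmult_le_pos; lra).
    apply Rmult_lt_reg_r with r; [lra|]. rewrite Rmult_assoc, Rinv_l; lra. }
  { apply Rdiv_lt_0_compat; lra. }
  specialize (Hn n (le_n n)).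
  assert (Hp : 0 <= (h * / r) ^ n) by (apply pow_le, Rmult_le_pos; lra).
  rewrite Rabs_pos_eq in Hn by auto.
  rewrite (Pw n), Cmod_mult, Cmod_pow. fold h.
  apply Rle_trans with (h ^ n * (2 * PI * (B * (/ r) ^ n * / (r - h)))).
  apply Rmult_le_compat_l; auto. now apply pow_le.
  replace (h ^ n * (2 * PI * (B * (/ r) ^ n * / (r - h)))) with (K * (h * / r) ^ n).
  2:{ rewrite Rpow_mult_distr. unfold K. ring. }
  apply Rle_trans with ((K + 1) * (e / (K + 1))).
  apply Rmult_le_compat; auto; lra.
  right; field; lra. }
assert (CF := Cauchy_formula G z0 z r R0 HG Hr Hzr).
replace (Kint z0 r (fun t => dcirc r t * G (circ z0 r t))%C 1 z) with (Rn 0%nat z) in CF.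
2:{ unfold Rn, Kint. f_equal. apply functional_extensionality. intros t. unfold phi. simpl.
    fold (psi t). ring. }
rewrite Zero in CF.
replace (G z) with (/ (RtoC (2 * PI) * Ci) * (RtoC (2 * PI) * Ci * G z))%C.
rewrite <- CF. ring. rewrite Cmult_assoc, Cinv_l. ring. apply twoPIi_neq0.
Qed.

(** * Cauchy-Riemann equations, exponential, logarithm, power series *)

Lemma C1_differentiable (f fx : R -> R -> R) (x y fy : R) :
  locally_2d (fun u v => is_derive (fun z => f z v) u (fx u v)) x y ->
  is_derive (fun z => f x z) y fy -> continuity_2d_pt fx x y ->
  differentiable_pt_lim f x y (fx x y) fy.
Proof.
intros H1 H2 H3. apply filterdiff_differentiable_pt_lim.
exact (is_derive_filterdiff f x y fx fy (proj1 (locally_2d_locally _ _ _) H1) H2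
  (proj1 (continuity_2d_pt_filterlim _ _ _) H3)).
Qed.

Lemma Cauchy_Riemann (u v : R -> R -> R) (x y p q : R) :
  differentiable_pt_lim u x y p (- q) -> differentiable_pt_lim v x y q p ->
  Cder (fun z => (u (fst z) (snd z), v (fst z) (snd z))) (x, y) (p, q).
Proof.
intros Hu Hv. apply Cder_eps. intros eps He.
assert (He2 : 0 < eps / 2) by lra.
destruct (Hu (mkposreal _ He2)) as [d1 H1]. destruct (Hv (mkposreal _ He2)) as [d2 H2].
exists (Rmin d1 d2). split. apply Rmin_pos; apply cond_pos.
intros [x' y'] Hw.
assert (M := Rmax_Cmod ((x', y') - (x, y))%C).
set (d := Cmod ((x', y') - (x, y))%C) in *.
change (Rmax (Rabs (x' - x)) (Rabs (y' - y)) <= d) in M.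
assert (A1 := Rle_trans _ _ _ (Rmax_l _ _) M). assert (A2 := Rle_trans _ _ _ (Rmax_r _ _) M).
assert (B1 := Rlt_le_trans _ _ _ Hw (Rmin_l _ _)).
assert (B2 := Rlt_le_trans _ _ _ Hw (Rmin_r _ _)).
specialize (H1 x' y'). specialize (H2 x' y'). simpl in H1, H2.
eapply Rle_trans; [apply Cmod_2Rmax|]. simpl fst; simpl snd.
assert (S2 := sqrt2_le_2).
match goal with |- sqrt 2 * ?m <= _ => assert (E : m <= eps / 2 * d) end.
{ apply Rmax_lub.
  - replace (u x' y' + - u x y + - ((x' + - x) * p - (y' + - y) * q)) with
     (u x' y' - u x y - (p * (x' - x) + - q * (y' - y))) by ring.
    eapply Rle_trans; [apply H1; lra|]. apply Rmult_le_compat_l; lra.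
  - replace (v x' y' + - v x y + - ((x' + - x) * q + (y' + - y) * p)) with
     (v x' y' - v x y - (q * (x' - x) + p * (y' - y))) by ring.
    eapply Rle_trans; [apply H2; lra|]. apply Rmult_le_compat_l; lra. }
match goal with |- sqrt 2 * ?m <= _ => assert (0 <= m) end.
{ eapply Rle_trans; [|apply Rmax_l]. apply Rabs_pos. }
nra.
Qed.

Lemma continuity_2d_1 (f : R -> R) (x y : R) : continuity_pt f x -> continuity_2d_pt (fun u _
  => f u) x y.
Proof. intros H. apply (continuity_1d_2d_pt_comp f (fun u _ => u)); auto.
apply continuity_2d_pt_id1. Qed.
Lemma continuity_2d_2 (f : R -> R) (x y : R) : continuity_pt f y -> continuity_2d_pt (fun _ v
  => f v) x y.
Proof. intros H. apply (continuity_1d_2d_pt_comp f (fun _ u => u)); auto.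
apply continuity_2d_pt_id2. Qed.

Lemma locally_2d_all (P : R -> R -> Prop) (x y : R) : (forall u v, P u v) -> locally_2d P x y.
Proof. intros H. exists (mkposreal 1 Rlt_0_1). auto. Qed.

Lemma Cder_Cexp (z : C) : Cder Cexp z (Cexp z).
Proof.
destruct z as [x y].
apply (Cauchy_Riemann (fun x y => exp x * cos y) (fun x y => exp x * sin y)).
- apply (C1_differentiable _ (fun x y => exp x * cos y)).
  + apply locally_2d_all. intros u v. auto_derive; auto; simpl; ring.
  + auto_derive; auto; simpl; ring.
  + apply continuity_2d_pt_mult. apply continuity_2d_1, derivable_continuous, derivable_exp.
    apply continuity_2d_2, continuity_cos.
- apply (C1_differentiable _ (fun x y => exp x * sin y)).
  + apply locally_2d_all. intros u v. auto_derive; auto; simpl; ring.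
  + auto_derive; auto; simpl; ring.
  + apply continuity_2d_pt_mult. apply continuity_2d_1, derivable_continuous, derivable_exp.
    apply continuity_2d_2, continuity_sin.
Qed.

(** The principal logarithm on the right half-plane, where [atan (y / x)] is the argument. It is
    applied where an extension of [a] has positive real part. *)
Definition Clog (z : C) : C :=
  (ln (fst z * fst z + snd z * snd z) / 2, atan (snd z / fst z)).

Lemma Cdiff_Clog (z : C) : 0 < fst z -> Cdiff_at Clog z.
Proof.
destruct z as [x y]; simpl; intros Hx.
assert (L : locally_2d (fun u v => 0 < u) x y).
{ exists (mkposreal x Hx). simpl. intros u v Hu _. apply Rabs_def2 in Hu. lra. }
assert (N : forall u v, 0 < u -> 0 < u * u + v * v) by (intros; nra).
assert (Cn : continuity_2d_pt (fun u v => u * u + v * v) x y).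
{ apply continuity_2d_pt_plus; apply continuity_2d_pt_mult;
  apply continuity_2d_pt_id1 || apply continuity_2d_pt_id2. }
exists (x / (x * x + y * y), - y / (x * x + y * y)).
apply (Cauchy_Riemann (fun x y => ln (x * x + y * y) / 2) (fun x y => atan (y / x))).
- apply (C1_differentiable _ (fun x y => x / (x * x + y * y))).
  + destruct L as [d L]. exists d. intros u v Hu Hv. specialize (L u v Hu Hv). simpl in L.
    assert (Nu := N u v L). auto_derive; auto. field. lra.
  + assert (Nu := N x y Hx). auto_derive; auto. field. lra.
  + apply continuity_2d_pt_mult. apply continuity_2d_pt_id1.
    apply continuity_2d_pt_inv; auto. generalize (N x y Hx); lra.
- apply (C1_differentiable _ (fun x y => - y / (x * x + y * y))).
  + destruct L as [d L]. exists d. intros u v Hu Hv. specialize (L u v Hu Hv). simpl in L.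
    assert (Nu := N u v L). auto_derive; [lra|]. field. split; nra.
  + assert (Nu := N x y Hx). auto_derive; [lra|]. field. split; nra.
  + apply continuity_2d_pt_mult. apply continuity_2d_pt_opp, continuity_2d_pt_id2.
    apply continuity_2d_pt_inv; auto. generalize (N x y Hx); lra.
Qed.

(** * Power series at complex arguments *)

(** Second-order Taylor remainder of the power, with the coefficients of the second derivative so
    that it can be summed against a power series. For [n <= 1] the factor [INR n * INR (pred n)] is
    zero, whatever the truncated exponent. *)
Lemma Cpow_increment_bound (h k : C) (rho : R) (n : nat) :
  Cmod h <= rho -> Cmod (h + k)%C <= rho ->
  Cmod ((h + k) ^ n - h ^ n - k * (RtoC (INR n) * h ^ pred n))%C
    <= INR n * INR (pred n) * rho ^ pred (pred n) * (Cmod k * Cmod k).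
Proof.
intros Hh Hhk. assert (Hr : 0 <= rho) by (generalize (Cmod_ge_0 h); lra).
assert (Hk := Cmod_ge_0 k).
induction n as [|n IH].
- simpl. match goal with |- Cmod ?e <= _ => replace e with (RtoC 0) by ring end.
  rewrite Cmod_0. lra.
- change (pred (S n)) with n.
  set (En := ((h + k) ^ n - h ^ n - k * (RtoC (INR n) * h ^ pred n))%C) in *.
  assert (E : ((h + k) ^ S n - h ^ S n - k * (RtoC (INR (S n)) * h ^ n))%C =
     ((h + k) * En + RtoC (INR n) * k * k * h ^ pred n)%C).
  { destruct n as [|n].
    - unfold En. simpl. ring.
    - unfold En. change (pred (S n)) with n. rewrite (S_INR (S n)), RtoC_plus. simpl Cpow.
      ring. }
  rewrite E. eapply Rle_trans; [apply Cmod_triangle|].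
  rewrite !Cmod_mult, Cmod_pow, Cmod_R, Rabs_pos_eq by apply pos_INR.
  assert (P1 : Cmod h ^ pred n <= rho ^ pred n) by (apply pow_incr; split; auto;
  apply Cmod_ge_0).
  assert (Hn := pos_INR n). assert (Hpn := pos_INR (pred n)).
  assert (P2 : 0 <= rho ^ pred n) by now apply pow_le.
  assert (T1 : Cmod (h + k)%C * Cmod En <= INR n * INR (pred n) * rho ^ pred n * (Cmod k *
  Cmod k)).
  { apply Rle_trans with (rho * (INR n * INR (pred n) * rho ^ pred (pred n) * (Cmod k * Cmod
    k))).
    apply Rmult_le_compat; auto using Cmod_ge_0.
    destruct n as [|[|n]]; simpl pred; [simpl; lra|simpl; lra|]. simpl pow. right; ring. }
  assert (T2 : INR n * Cmod k * Cmod k * Cmod h ^ pred n <= INR n * rho ^ pred n * (Cmod k *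
  Cmod k)).
  { replace (INR n * Cmod k * Cmod k * Cmod h ^ pred n) with (INR n * Cmod h ^ pred n * (Cmod
    k * Cmod k)) by ring.
    apply Rmult_le_compat_r. now apply Rmult_le_pos. now apply Rmult_le_compat_l. }
  assert (T3 : INR n * INR (pred n) + INR n <= INR (S n) * INR n).
  { destruct n. simpl; lra. change (pred (S n)) with n. rewrite !S_INR.
    assert (0 <= INR n) by apply pos_INR. nra. }
  assert (T4 : (INR n * INR (pred n) + INR n) * (rho ^ pred n * (Cmod k * Cmod k)) <=
     INR (S n) * INR n * (rho ^ pred n * (Cmod k * Cmod k))).
  { apply Rmult_le_compat_r; auto. apply Rmult_le_pos; auto. now apply Rmult_le_pos. }
  lra.
Qed.

Local Ltac eqR := match goal with |- @eq _ ?a ?b => change (@eq R a b) end; ring.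

Lemma Series_zero (a : nat -> R) : (forall n, a n = 0) -> Series a = 0.
Proof.
intros H. rewrite (Series_ext a (fun n => 0 * a n)).
rewrite Series_scal_l. ring. intros n. rewrite H. ring.
Qed.

(** [Series] is total, so convergence is recorded apart, in [Csummable]. *)
Definition Cseries (w : nat -> C) : C :=
  (Series (fun n => fst (w n)), Series (fun n => snd (w n))).

Lemma Cmod_Cseries_le (w : nat -> C) (b : nat -> R) :
  (forall n, Cmod (w n) <= b n) -> ex_series b ->
  Cmod (Cseries w) <= 2 * Series b.
Proof.
intros H Hb.
assert (P : forall f : nat -> R, (forall n, Rabs (f n) <= b n) -> Rabs (Series f) <= Series b).
{ intros f Hf. eapply Rle_trans; [apply Series_Rabs|].
  - apply (@ex_series_le R_AbsRing R_CompleteNormedModule _ b); auto. intros n.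
    unfold norm; simpl. unfold abs; simpl. rewrite Rabs_Rabsolu. auto.
  - apply Series_le; auto. intros n. split; auto. apply Rabs_pos. }
eapply Rle_trans; [apply Cmod_2Rmax|].
assert (S2 := sqrt2_le_2).
assert (M : Rmax (Rabs (fst (Cseries w))) (Rabs (snd (Cseries w))) <= Series b).
{ apply Rmax_lub; apply P; intros n; (eapply Rle_trans; [|apply H]);
  (eapply Rle_trans; [|apply Rmax_Cmod]). apply Rmax_l. apply Rmax_r. }
assert (0 <= Rmax (Rabs (fst (Cseries w))) (Rabs (snd (Cseries w)))).
{ eapply Rle_trans; [|apply Rmax_l]. apply Rabs_pos. }
nra.
Qed.

Definition Csummable (w : nat -> C) := ex_series (fun n => fst (w n)) /\ ex_series (fun n =>
snd (w n)).

Lemma Csummable_le (w : nat -> C) (b : nat -> R) :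
  (forall n, Cmod (w n) <= b n) -> ex_series b -> Csummable w.
Proof.
intros H Hb.
split; apply (@ex_series_le R_AbsRing R_CompleteNormedModule _ b); auto; intros n;
(eapply Rle_trans; [|apply H]); (eapply Rle_trans; [|apply Rmax_Cmod]). apply Rmax_l.
apply Rmax_r.
Qed.

Lemma Cseries_minus (v w : nat -> C) : Csummable v -> Csummable w ->
  Cseries (fun n => v n - w n)%C = (Cseries v - Cseries w)%C.
Proof.
intros [H1 H2] [H3 H4]. unfold Cseries. apply injective_projections; simpl.
- now apply Series_minus.
- now apply Series_minus.
Qed.

Lemma Cseries_mult_l (k : C) (w : nat -> C) : Csummable w ->
  Cseries (fun n => k * w n)%C = (k * Cseries w)%C.
Proof.
intros [H1 H2].
assert (S : forall (c : R) f, ex_series f -> ex_series (fun n => c * f n)).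
{ intros c f Hf. apply (@ex_series_scal R_AbsRing R_NormedModule c f Hf). }
unfold Cseries. apply injective_projections; simpl.
- rewrite Series_minus by auto. now rewrite !Series_scal_l.
- rewrite Series_plus by auto. now rewrite !Series_scal_l.
Qed.

(** Differentiation term by term: the summed remainders are at most [2 * Series b2] times
    [Cmod k * Cmod k]. *)
Lemma power_series_Cdiff (c : nat -> R) (r : R) (h : C) :
  (forall y, Rabs y < r -> ex_pseries c y) -> Cmod h < r ->
  Cdiff_at (fun z => Cseries (fun n => RtoC (c n) * z ^ n)%C) h.
Proof.
intros Hc Hh.
assert (Hh0 := Cmod_ge_0 h).
(* Convergence at [rho'] puts the radius of convergence strictly beyond [rho]; the gap between
   [Cmod h] and [rho] is the room for [w]. *)
set (rho := (Cmod h + r) / 2).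
set (rho' := (rho + r) / 2).
assert (Hrho : Cmod h < rho < rho' /\ rho' < r) by (unfold rho', rho; lra).
assert (CV : Rbar_lt (Rabs rho) (CV_radius c)).
{ apply Rbar_lt_le_trans with (Rabs rho').
  - simpl. rewrite !Rabs_pos_eq; lra.
  - apply Rbar_not_lt_le. intros K. apply (CV_disk_outside _ _ K).
    assert (E : ex_pseries c rho') by (apply Hc; rewrite Rabs_pos_eq; lra).
    apply ex_series_lim_0. eapply ex_series_ext; [|exact E].
    intros n. unfold scal; simpl. unfold mult; simpl.
    rewrite pow_n_pow. ring. }
(* Majorants on the disc of radius [rho] of the series and of its first and second formal
   derivatives. *)
set (b0 := fun n => Rabs (c n) * rho ^ n).
set (b1 := fun n => Rabs (c n) * (INR n * rho ^ pred n)).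
set (b2 := fun n => Rabs (c n) * (INR n * INR (pred n) * rho ^ pred (pred n))).
assert (Hp : forall n, Rabs (rho ^ n) = rho ^ n).
{ intros n. apply Rabs_pos_eq, pow_le. lra. }
assert (Hi : forall n, Rabs (INR n) = INR n) by (intros; apply Rabs_pos_eq, pos_INR).
assert (S0 : ex_series b0).
{ eapply ex_series_ext; [|apply (CV_disk_inside _ _ CV)]. intros n. simpl.
  rewrite Rabs_mult, Hp. reflexivity. }
assert (S1 : ex_series b1).
(* [PS_derive] shifts the index: its term [n] corresponds to term [S n] of [b1]. *)
{ apply ex_series_incr_1.
  eapply ex_series_ext; [|apply (CV_disk_inside (PS_derive c) rho)].
  2: now rewrite CV_radius_derive.
  intros n. unfold b1, PS_derive. rewrite !Rabs_mult, Hp, Hi. simpl pred. eqR. }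
assert (S2 : ex_series b2).
{ apply ex_series_incr_1, ex_series_incr_1.
  eapply ex_series_ext; [|apply (CV_disk_inside (PS_derive (PS_derive c)) rho)].
  2: now rewrite !CV_radius_derive.
  intros n. unfold b2, PS_derive. rewrite !Rabs_mult, Hp, !Hi. simpl pred. eqR. }
set (D := fun n => (RtoC (c n) * (RtoC (INR n) * h ^ pred n))%C).
assert (SD : Csummable D).
{ apply (Csummable_le D b1); auto. intros n. unfold D, b1.
  rewrite !Cmod_mult, !Cmod_R, Hi, Cmod_pow.
  apply Rmult_le_compat_l; [apply Rabs_pos|]. apply Rmult_le_compat_l; [apply pos_INR|].
  apply pow_incr; lra. }
assert (SF : forall z, Cmod z <= rho -> Csummable (fun n => (RtoC (c n) * z ^ n)%C)).
{ intros z Hz. apply (Csummable_le _ b0); auto. intros n. unfold b0.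
  rewrite !Cmod_mult, !Cmod_R, Cmod_pow.
  apply Rmult_le_compat_l; [apply Rabs_pos|].
  apply pow_incr; split; auto. apply Cmod_ge_0. }
exists (Cseries D). apply Cder_eps. intros eps He.
set (B := 2 * Series b2).
assert (HB : 0 <= B).
{ unfold B. assert (0 <= Series b2); [|lra].
  replace 0 with (Series (fun _ => 0)). apply Series_le; auto.
  intros n. unfold b2. split; [lra|]. apply Rmult_le_pos; [apply Rabs_pos|].
  apply Rmult_le_pos; [apply Rmult_le_pos; apply pos_INR|]. apply pow_le; lra.
  apply Series_zero. auto. }
exists (Rmin (rho - Cmod h) (eps / (B + 1))). split.
{ apply Rmin_pos. lra. apply Rdiv_lt_0_compat; lra. }
intros w Hw.
assert (W1 := Rlt_le_trans _ _ _ Hw (Rmin_l _ _)).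
assert (W2 := Rlt_le_trans _ _ _ Hw (Rmin_r _ _)).
set (k := (w - h)%C) in *.
assert (Ew : w = (h + k)%C) by (unfold k; ring).
assert (Hwr : Cmod (h + k)%C <= rho).
{ eapply Rle_trans; [apply Cmod_triangle|]. lra. }
rewrite Ew.
rewrite <- Cseries_minus, <- Cseries_mult_l, <- Cseries_minus; auto.
2:{ destruct (SF _ Hwr) as [A1 A2]. assert (Hhr : Cmod h <= rho) by lra.
destruct (SF _ Hhr) as [A3 A4].
    split. apply (@ex_series_minus R_AbsRing R_NormedModule _ _ A1 A3).
    apply (@ex_series_minus R_AbsRing R_NormedModule _ _ A2 A4). }
2:{ apply (Csummable_le _ (fun n => Cmod k * b1 n)).
    - intros n. unfold D, b1. rewrite !Cmod_mult, !Cmod_R, Hi, Cmod_pow.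
      apply Rmult_le_compat_l; [apply Cmod_ge_0|].
      apply Rmult_le_compat_l; [apply Rabs_pos|]. apply Rmult_le_compat_l; [apply pos_INR|].
      apply pow_incr; lra.
    - apply (@ex_series_scal R_AbsRing R_NormedModule _ b1 S1). }
2: apply SF; lra.
assert (Hk := Cmod_ge_0 k).
eapply Rle_trans.
{ apply (Cmod_Cseries_le _ (fun n => (Cmod k * Cmod k) * b2 n)).
  - intros n. unfold D, b2.
    replace (c n * (h + k) ^ n - c n * h ^ n - k * (c n * (INR n * h ^ pred n)))%C
      with (RtoC (c n) * ((h + k) ^ n - h ^ n - k * (INR n * h ^ pred n)))%C by ring.
    rewrite Cmod_mult, Cmod_R.
    apply Rle_trans with (Rabs (c n) * (INR n * INR (pred n) * rho ^ pred (pred n) * (Cmod k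
    * Cmod k))).
    apply Rmult_le_compat_l; [apply Rabs_pos|]. apply Cpow_increment_bound; lra.
    right; ring.
  - apply (@ex_series_scal R_AbsRing R_NormedModule _ b2 S2). }
rewrite Series_scal_l.
replace (2 * (Cmod k * Cmod k * Series b2)) with (B * Cmod k * Cmod k) by (unfold B; ring).
apply Rmult_le_compat_r; auto.
apply Rle_trans with ((B + 1) * (eps / (B + 1))).
apply Rmult_le_compat; lra. right; field; lra.
Qed.

Lemma real_analytic_extends (g : R -> R) (x r : R) (c : nat -> R) :
  (forall y, Rabs (y - x) < r -> is_pseries c (y - x) (g y)) ->
  exists F : C -> C,
    (forall z, Cmod (z - RtoC x)%C < r -> Cdiff_at F z) /\
    forall s, Rabs (s - x) < r -> F (RtoC s) = RtoC (g s).
Proof.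
intros H. set (S := fun z => Cseries (fun n => RtoC (c n) * z ^ n)%C).
exists (fun z => S (z - RtoC x)%C). split.
- intros z Hz.
  assert (HS : Cdiff_at S (z - RtoC x)%C).
  { apply power_series_Cdiff with r; auto. intros y Hy.
    exists (g (y + x)). specialize (H (y + x)). replace (y + x - x) with y in H by ring.
    exact (H Hy). }
  destruct HS as [l Hl]. eexists. apply (Cder_comp S (fun z => z - RtoC x)%C). exact Hl.
  apply Cder_minus; [apply Cder_id|apply Cder_const].
- intros s Hs. specialize (H s Hs). unfold S.
  assert (Q : forall n, (RtoC (c n) * (RtoC s - RtoC x) ^ n)%C = RtoC (c n * (s - x) ^ n)).
  { intros n. rewrite <- RtoC_minus, <- RtoC_pow, <- RtoC_mult. reflexivity. }
  replace (fun n => RtoC (c n) * (RtoC s - RtoC x) ^ n)%C with (fun n => RtoC (c n * (s - x)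
  ^ n)).
  2:{ apply functional_extensionality. intros n. now rewrite Q. }
  unfold Cseries. apply injective_projections; simpl.
  + apply is_series_unique. eapply is_series_ext; [|exact H].
    intros n. unfold scal; simpl. unfold mult; simpl. rewrite pow_n_pow. apply Rmult_comm.
  + apply Series_zero. reflexivity.
Qed.

(** * Gluing local extensions *)

Lemma Sq_mono (z0 z : C) (r r1 : R) : r1 <= r -> Sq z0 r1 z -> Sq z0 r z.
Proof. intros H [H1 H2]. split; lra. Qed.

Lemma Cmod_sub_fst (z : C) : Cmod (z - RtoC (fst z))%C = Rabs (snd z).
Proof.
destruct z as [x y]; simpl.
replace ((x, y) - RtoC x)%C with (Ci * RtoC y)%C by (apply injective_projections; simpl; ring).
now rewrite Cmod_mult, Cmod_Ci, Cmod_R, Rmult_1_l.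
Qed.

Lemma open_intro (U : C -> Prop) :
  (forall z, U z -> exists d, 0 < d /\ forall w, Cmod (w - z)%C < d -> U w) -> open U.
Proof. intros H z Hz. apply locally_Cmod. auto. Qed.

Lemma open_elim (U : C -> Prop) (z : C) : open U -> U z ->
  exists d, 0 < d /\ forall w, Cmod (w - z)%C < d -> U w.
Proof. intros H Hz. apply locally_Cmod. now apply H. Qed.

Definition local_ext (g : R -> R) (x r : R) (H : C -> C) : Prop :=
  holomorphic_on (Sq (RtoC x) r) H /\ forall s : R, Rabs (s - x) < r -> H (RtoC s) = RtoC (g s).

(** The identity principle for [H1 - H2], which is zero on a real segment around the common centre
    [x]. *)
Lemma local_ext_unique (g : R -> R) (x r1 r2 : R) (H1 H2 : C -> C) (z : C) :
  local_ext g x r1 H1 -> local_ext g x r2 H2 ->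
  Cmod (z - RtoC x)%C < Rmin r1 r2 -> H1 z = H2 z.
Proof.
intros [A1 B1] [A2 B2] Hz.
assert (Hr : 0 < Rmin r1 r2) by (generalize (Cmod_ge_0 (z - RtoC x)%C); lra).
assert (E : (H1 z - H2 z)%C = RtoC 0).
{ apply (identity_principle (fun z => H1 z - H2 z)%C (RtoC x) z (Rmin r1 r2) (Rmin r1 r2));
  auto.
  - intros w Hw.
    destruct (A1 w) as [l1 L1]. { eapply Sq_mono; [apply Rmin_l|exact Hw]. }
    destruct (A2 w) as [l2 L2]. { eapply Sq_mono; [apply Rmin_r|exact Hw]. }
    eexists. exact (Cder_minus _ _ _ _ _ L1 L2).
  - intros s Hs. rewrite <- RtoC_plus.
    replace (x + s) with (s + x) by ring.
    rewrite B1, B2. ring.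
    replace (s + x - x) with s by ring. eapply Rlt_le_trans; [exact Hs|apply Rmin_r].
    replace (s + x - x) with s by ring. eapply Rlt_le_trans; [exact Hs|apply Rmin_l]. }
replace (H1 z) with ((H1 z - H2 z) + H2 z)%C by ring. rewrite E. ring.
Qed.

Lemma local_ext_recenter (g : R -> R) (x r x' r' : R) (H : C -> C) :
  Rabs (x' - x) + r' <= r -> local_ext g x r H -> local_ext g x' r' H.
Proof.
intros Hx [A B]. split.
- intros [s t] [H1 H2]. apply A. unfold Sq in *; simpl in *.
  assert (Hp := Rabs_pos (x' - x)).
  split; [|lra].
  replace (s - x) with ((s - x') + (x' - x)) by ring.
  eapply Rle_lt_trans; [apply Rabs_triang|]. lra.
- intros s Hs. apply B.
  replace (s - x) with ((s - x') + (x' - x)) by ring.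
  eapply Rle_lt_trans; [apply Rabs_triang|]. lra.
Qed.

(* The global extension takes at [z] the value common to all local extensions
   on squares centred at [Re z] that contain [z]. *)
Lemma glue_extensions (I : R -> Prop) (g : R -> R) :
  (forall x, I x -> exists r H, 0 < r /\ local_ext g x r H) ->
  exists F, holomorphic_extension I g F.
Proof.
intros HI.
set (Val := fun z w => exists r H, Rabs (snd z) < r /\ local_ext g (fst z) r H /\ H z = w).
assert (VU : forall z w w', Val z w -> Val z w' -> w = w').
{ intros z w w' (r & H & Hr & L & <-) (r' & H' & Hr' & L' & <-).
  apply (local_ext_unique g (fst z) r r' H H' z); auto.
  rewrite Cmod_sub_fst. now apply Rmin_glb_lt. }
set (F := fun z => epsilon (inhabits (RtoC 0)) (Val z)).
assert (FV : forall z w, Val z w -> F z = w).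
{ intros z w Hw. apply (VU z); auto. unfold F. apply epsilon_spec. now exists w. }
(* Half the radius leaves room to recentre at [Re z]: a square of size [r / 2] there is still inside
   the given one. *)
assert (FH : forall x r H z, local_ext g x r H -> Sq (RtoC x) (r / 2) z -> F z = H z).
{ intros x r H z L [H1 H2]. simpl in H1, H2. rewrite Rminus_0_r in H2.
  apply FV. exists (r / 2), H. split; [auto|]. split; [|auto].
  apply (local_ext_recenter g x r (fst z) (r / 2) H); auto; lra. }
exists F.
set (U := fun z => exists x r H, I x /\ 0 < r /\ local_ext g x r H /\ Sq (RtoC x) (r / 2) z).
assert (HU : forall s, I s -> U (RtoC s)).
{ intros s Hs. destruct (HI s Hs) as (r & H & Hr & L). exists s, r, H. split; [auto|].
  split; [auto|]. split; [auto|].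
  split; simpl. rewrite Rminus_diag, Rabs_R0; lra. rewrite Rminus_0_r, Rabs_R0; lra. }
assert (OU : forall z, U z -> exists d, 0 < d /\ forall w, Cmod (w - z)%C < d -> U w).
{ intros z (x & r & H & Hx & Hr & L & Hz). destruct (Sq_open _ _ _ Hz) as (d & Hd & K).
  exists d. split; auto. intros w Hw. exists x, r, H. auto. }
split.
- exists U. split; [split|]; auto. now apply open_intro.
  intros z (x & r & H & Hx & Hr & L & Hz).
  destruct (Sq_open _ _ _ Hz) as (d & Hd & K).
  apply (Cdiff_at_ext_near H F z d); auto.
  intros w Hw. symmetry. apply (FH x r); auto.
  apply L. apply (Sq_mono _ _ _ (r / 2)); auto. lra.
- intros s Hs. destruct (HI s Hs) as (r & H & Hr & L).
  rewrite (FH s r H); auto. apply L. rewrite Rminus_diag, Rabs_R0; lra.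
  split; simpl. rewrite Rminus_diag, Rabs_R0; lra. rewrite Rminus_0_r, Rabs_R0; lra.
Qed.

Lemma Sq_Cmod (z0 z : C) (r : R) : Sq z0 (r / 2) z -> Cmod (z - z0)%C < r.
Proof.
destruct z as [x y], z0 as [x0 y0]. intros [H1 H2]; simpl in *.
eapply Rle_lt_trans; [apply Cmod_pair_le|]. lra.
Qed.

(** * Local extensions of the data, of [sqrt a] and of theta *)

Lemma analytic_local_ext (I : R -> Prop) (g : R -> R) (x : R) :
  real_analytic_on I g -> I x -> exists r H, 0 < r /\ local_ext g x r H.
Proof.
intros Hg Hx. destruct (Hg x Hx) as (c & r & Hr & Hc).
destruct (real_analytic_extends g x r c Hc) as (F & F1 & F2).
exists (r / 2), F. split; [lra|]. split.
- intros z Hz. now apply F1, Sq_Cmod.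
- intros s Hs. apply F2. lra.
Qed.

Lemma Pder_RtoC (t : R) : Pder RtoC t (RtoC 1).
Proof. apply (Pder_Hline 0). Qed.

(** The complex derivative may be computed along the real axis, where [H] is real. This later lets
    the Cauchy data be read off [A] and [T]. *)
Lemma local_ext_derive (g : R -> R) (x r s : R) (H : C -> C) (l : C) :
  local_ext g x r H -> Rabs (s - x) < r -> Cder H (RtoC s) l ->
  is_derive g s (fst l) /\ snd l = 0.
Proof.
intros [A B] Hs Hl.
assert (P := Pder_comp H RtoC s _ _ Hl (Pder_RtoC s)).
assert (E : locally s (fun t => H (RtoC t) = RtoC (g t))).
{ assert (Hd : 0 < r - Rabs (s - x)) by lra.
  exists (mkposreal _ Hd). intros t Ht. apply B.
  change (Rabs (t - s) < r - Rabs (s - x)) in Ht.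
  replace (t - x) with ((t - s) + (s - x)) by ring.
  eapply Rle_lt_trans; [apply Rabs_triang|]. lra. }
split.
- apply (is_derive_ext_loc (fun t => fst (H (RtoC t)))).
  { eapply filter_imp; [|exact E]. intros t Ht. simpl. now rewrite Ht. }
  replace (fst l) with (fst (RtoC 1 * l)%C) by (simpl; ring).
  now apply (Pder_fst (fun t => H (RtoC t))).
- assert (D1 : is_derive (fun t => snd (H (RtoC t))) s (snd (RtoC 1 * l)%C)).
  { now apply (Pder_snd (fun t => H (RtoC t))). }
  assert (D2 : is_derive (fun t => snd (H (RtoC t))) s 0).
  { apply (is_derive_ext_loc (fun _ => 0)).
    { eapply filter_imp; [|exact E]. intros t Ht. simpl. now rewrite Ht. }
    apply @is_derive_const. }
  apply is_derive_unique in D1. apply is_derive_unique in D2. rewrite D1 in D2. simpl in D2.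
  lra.
Qed.

(** The left side is what [Cexp (Clog / 2)] gives at a positive real. *)
Lemma sqrt_exp_ln (x : R) : 0 < x -> exp (ln (x * x) / 2 / 2) = sqrt x.
Proof.
intros Hx. rewrite ln_mult by auto. symmetry.
apply sqrt_lem_1. lra. left; apply exp_pos.
rewrite <- exp_plus. replace ((ln x + ln x) / 2 / 2 + (ln x + ln x) / 2 / 2) with (ln x) by
field.
now apply exp_ln.
Qed.

Lemma local_ext_positive (g : R -> R) (x r : R) (H : C -> C) :
  0 < r -> local_ext g x r H -> 0 < g x ->
  exists r', 0 < r' <= r /\ forall z, Sq (RtoC x) r' z -> 0 < fst (H z).
Proof.
intros Hr [A B] Hg.
assert (Hx : Sq (RtoC x) r (RtoC x)).
{ split; simpl; rewrite Rminus_diag, Rabs_R0; lra. }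
destruct (Cdiff_cont _ _ (A _ Hx) (g x) Hg) as (d & Hd & K).
exists (Rmin r (d / 2)). split. split. apply Rmin_pos; lra. apply Rmin_l.
intros z Hz.
assert (Hzd : Cmod (z - RtoC x)%C < d).
{ apply Sq_Cmod. eapply Sq_mono; [|exact Hz]. apply Rmin_r. }
specialize (K z Hzd). rewrite B in K by (rewrite Rminus_diag, Rabs_R0; lra).
assert (M := Rle_lt_trans _ _ _ (re_le_Cmod _) K). unfold Re in M; simpl in M.
apply Rabs_def2 in M. lra.
Qed.

(** The square is shrunk until [H] maps it into the right half-plane, where [Clog] is
    holomorphic. *)
Lemma sqrt_local_ext (g : R -> R) (x r : R) (H : C -> C) :
  0 < r -> local_ext g x r H -> 0 < g x ->
  exists r' K, 0 < r' /\ local_ext (fun s => sqrt (g s)) x r' K.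
Proof.
intros Hr L Hg. destruct (local_ext_positive g x r H Hr L Hg) as (r' & Hr' & P).
exists r', (fun z => Cexp (RtoC (/ 2) * Clog (H z))%C).
split; [lra|]. destruct L as [A B]. split.
- intros z Hz. destruct (Cdiff_Clog (H z) (P z Hz)) as [m Hm].
  destruct (A z) as [l Hl]. { eapply Sq_mono; [|exact Hz]. lra. }
  eexists. apply (Cder_comp Cexp). apply Cder_Cexp.
  apply Cder_scal. apply (Cder_comp Clog); eauto.
- intros s Hs.
  assert (Hp : 0 < g s).
  { assert (Q : Sq (RtoC x) r' (RtoC s)). split; simpl; auto. rewrite Rminus_0_r, Rabs_R0; lra.
    apply P in Q. rewrite B in Q by lra. exact Q. }
  rewrite B by lra. unfold Clog, Cexp; simpl.
  replace (0 / g s) with 0 by (unfold Rdiv; ring). rewrite atan_0.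
  replace (/ 2 * 0 + 0 * (ln (g s * g s + 0 * 0) / 2)) with 0 by ring.
  rewrite cos_0, sin_0. replace (g s * g s + 0 * 0) with (g s * g s) by ring.
  replace (/ 2 * (ln (g s * g s) / 2) - 0 * 0) with (ln (g s * g s) / 2 / 2) by field.
  rewrite sqrt_exp_ln by auto. apply injective_projections; simpl; ring.
Qed.

Lemma open_interval_open (I : R -> Prop) (s : R) : is_open_interval I -> I s ->
  exists d, 0 < d /\ forall t, Rabs (t - s) < d -> I t.
Proof.
intros (al & be & H) Hs. apply H in Hs. destruct Hs as [H1 H2].
assert (D1 : exists d, 0 < d /\ forall t, Rabs (t - s) < d -> Rbar_lt al t).
{ destruct al as [a| |]; simpl in *.
  - exists (s - a). split; [lra|]. intros t Ht. apply Rabs_def2 in Ht. lra.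
  - contradiction.
  - exists 1. split; [lra|auto]. }
assert (D2 : exists d, 0 < d /\ forall t, Rabs (t - s) < d -> Rbar_lt t be).
{ destruct be as [a| |]; simpl in *.
  - exists (a - s). split; [lra|]. intros t Ht. apply Rabs_def2 in Ht. lra.
  - exists 1. split; [lra|auto].
  - contradiction. }
destruct D1 as (d1 & P1 & Q1), D2 as (d2 & P2 & Q2).
exists (Rmin d1 d2). split. now apply Rmin_pos.
intros t Ht. apply H. split; [apply Q1|apply Q2]; eapply Rlt_le_trans; try exact Ht.
apply Rmin_l. apply Rmin_r.
Qed.

Lemma open_interval_convex (I : R -> Prop) (s t u : R) : is_open_interval I -> I s -> I t ->
  between s t u -> I u.
Proof.
intros (al & be & H) Hs Ht [U1 U2]. apply H in Hs, Ht. apply H.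
destruct Hs as [A1 A2], Ht as [B1 B2]. split.
- apply Rbar_lt_le_trans with (Rmin s t); [|exact U1].
  unfold Rmin; destruct Rle_dec; auto.
- apply Rbar_le_lt_trans with (Rmax s t); [exact U2|].
  unfold Rmax; destruct Rle_dec; auto.
Qed.

Lemma analytic_ex_derive (I : R -> Prop) (g : R -> R) (x : R) :
  real_analytic_on I g -> I x -> ex_derive g x.
Proof.
intros Hg Hx. destruct (analytic_local_ext I g x Hg Hx) as (r & H & Hr & L).
assert (X : Sq (RtoC x) r (RtoC x)).
{ split; simpl; rewrite Rminus_diag, Rabs_R0; lra. }
destruct (proj1 L _ X) as [l Hl].
exists (fst l). apply (local_ext_derive g x r x H l); auto.
rewrite Rminus_diag, Rabs_R0; lra.
Qed.

Lemma theta_derive (I : R -> Prop) (a d : R -> R) (s0 s : R) :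
  is_open_interval I -> real_analytic_on I a -> real_analytic_on I d ->
  (forall s : R, I s -> 0 < a s) -> I s0 -> I s ->
  is_derive (theta_from a d s0) s (- (1 / 2) * (d s / a s)).
Proof.
intros hI ha hd ap h0 hs.
assert (Cq : forall t, I t -> continuous (fun r => d r / a r) t).
{ intros t Ht. apply (@ex_derive_continuous R_AbsRing R_NormedModule).
  apply ex_derive_div. now apply (analytic_ex_derive I). now apply (analytic_ex_derive I).
  apply Rgt_not_eq. now apply ap. }
unfold theta_from. apply @is_derive_scal.
apply (is_derive_RInt (fun r => d r / a r) (fun s => RInt (fun r => d r / a r) s0 s) s0).
- destruct (open_interval_open I s hI hs) as (e & He & K).
  exists (mkposreal _ He). intros t Ht. apply (@RInt_correct R_CompleteNormedModule).
  apply (@ex_RInt_continuous R_CompleteNormedModule). intros z Hz. apply Cq.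
  apply (open_interval_convex I s0 t); auto.
- now apply Cq.
Qed.

(** The extension is a complex primitive of [q] on a square, normalised to the value of theta at
    [x]; no power series of [d / a] is formed. *)
Lemma theta_local_ext (I : R -> Prop) (a d : R -> R) (s0 x : R) :
  is_open_interval I -> real_analytic_on I a -> real_analytic_on I d ->
  (forall s : R, I s -> 0 < a s) -> I s0 -> I x ->
  exists r H, 0 < r /\ local_ext (theta_from a d s0) x r H.
Proof.
intros hI ha hd ap h0 hx.
destruct (analytic_local_ext I a x ha hx) as (r1 & Fa & Hr1 & La).
destruct (analytic_local_ext I d x hd hx) as (r2 & Fd & Hr2 & Ld).
destruct (local_ext_positive a x r1 Fa Hr1 La (ap x hx)) as (r3 & Hr3 & P).
(* [r3] keeps [Fa] away from zero, [r4] keeps the real points in [I], where [theta_derive]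
   applies. *)
destruct (open_interval_open I x hI hx) as (r4 & Hr4 & HI).
set (r := Rmin r2 (Rmin r3 r4)).
assert (Hr : 0 < r) by (repeat apply Rmin_pos; lra).
assert (R2 : r <= r2) by apply Rmin_l.
assert (R3 : r <= r3) by (eapply Rle_trans; [apply Rmin_r|apply Rmin_l]).
assert (R4 : r <= r4) by (eapply Rle_trans; [apply Rmin_r|apply Rmin_r]).
set (q := fun z => (RtoC (- (1 / 2)) * (Fd z * / Fa z))%C).
assert (Hq : holomorphic_on (Sq (RtoC x) r) q).
{ intros z Hz.
  destruct (proj1 La z) as [l1 L1]. { eapply Sq_mono; [|exact Hz]; lra. }
  destruct (proj1 Ld z) as [l2 L2]. { eapply Sq_mono; [|exact Hz]; lra. }
  assert (N : Fa z <> RtoC 0).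
  { intros E. assert (K := P z (Sq_mono _ _ _ _ R3 Hz)). rewrite E in K. simpl in K. lra. }
  eexists. apply Cder_scal. apply Cder_mult; [exact L2|].
  apply (Cder_comp Cinv). now apply Cder_inv. exact L1. }
assert (X : Sq (RtoC x) r (RtoC x)).
{ split; simpl; rewrite Rminus_diag, Rabs_R0; lra. }
destruct (primitive_exists q (RtoC x) (RtoC x) r X) as [Q HQ].
{ intros z Hz. apply Cdiff_cont. auto. } { auto. }
set (th := theta_from a d s0).
exists r, (fun z => Q z - Q (RtoC x) + RtoC (th x))%C. split; auto.
assert (HD : forall z, Sq (RtoC x) r z -> Cder (fun z => Q z - Q (RtoC x) + RtoC (th x))%C z
(q z)).
{ intros z Hz. replace (q z) with (q z - RtoC 0 + RtoC 0)%C by ring.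
  apply Cder_plus; [|apply Cder_const]. apply Cder_minus; [auto|apply Cder_const]. }
split.
- intros z Hz. eexists. now apply HD.
- intros s Hs.
  (* The two candidates have the same derivative along the real segment and agree at [x]. *)
  set (e := fun t : R => ((Q (RtoC t) - Q (RtoC x) + RtoC (th x)) - RtoC (th t))%C).
  assert (De : forall t, Rabs (t - x) < r -> Pder e t (RtoC 0)).
  { intros t Ht.
    assert (It : I t) by (apply HI; lra).
    assert (St : Sq (RtoC x) r (RtoC t)). { split; simpl; auto.
    rewrite Rminus_0_r, Rabs_R0; lra. }
    replace (RtoC 0) with (RtoC 1 * q (RtoC t) - RtoC (- (1 / 2) * (d t / a t)))%C.
    - apply (@is_derive_minus R_AbsRing C_R_NormedModule).
      + apply (Pder_comp (fun z => Q z - Q (RtoC x) + RtoC (th x))%C RtoC); auto.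
        apply Pder_RtoC.
      + apply (Pder_pair th (fun _ => 0)). now apply (theta_derive I).
        apply @is_derive_const.
    - unfold q. rewrite (proj2 La), (proj2 Ld) by lra.
      rewrite RtoC_mult, RtoC_div. unfold Cdiv. ring. apply Rgt_not_eq. now apply ap. }
  assert (Eq : e x = e s).
  { destruct (Rtotal_order x s) as [Hxs|[->|Hxs]]; auto; [|symmetry];
    apply (@eq_is_derive C_R_NormedModule e); auto; intros t Ht; apply De;
    apply Rabs_def2 in Hs; apply Rabs_def1; lra. }
  assert (E0 : e x = RtoC 0) by (unfold e; ring).
  rewrite E0 in Eq.
  replace (Q (RtoC s) - Q (RtoC x) + RtoC (th x))%C with (e s + RtoC (th s))%C by (unfold e;
  ring).
  rewrite <- Eq. ring.
Qed.

(** * Second order calculus in the plane *)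

(** Explicit partials in place of nested [Derive], so that [ln f] and [|F|^2] can be treated by
    formulas. The mixed partials are kept apart, since [ex_diff_n] involves both; [C2_on_Schwarz]
    identifies them. *)
Record C2_on (U : C -> Prop) (f fx fy fxx fxy fyx fyy : R -> R -> R) : Prop := {
  C2_x : forall x y, U (x, y) -> is_derive (fun s => f s y) x (fx x y);
  C2_y : forall x y, U (x, y) -> is_derive (fun t => f x t) y (fy x y);
  C2_xx : forall x y, U (x, y) -> is_derive (fun s => fx s y) x (fxx x y);
  C2_xy : forall x y, U (x, y) -> is_derive (fun t => fx x t) y (fxy x y);
  C2_yx : forall x y, U (x, y) -> is_derive (fun s => fy s y) x (fyx x y);
  C2_yy : forall x y, U (x, y) -> is_derive (fun t => fy x t) y (fyy x y);
  C2_c : forall x y, U (x, y) -> continuity_2d_pt f x y;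
  C2_cx : forall x y, U (x, y) -> continuity_2d_pt fx x y;
  C2_cy : forall x y, U (x, y) -> continuity_2d_pt fy x y;
  C2_cxx : forall x y, U (x, y) -> continuity_2d_pt fxx x y;
  C2_cxy : forall x y, U (x, y) -> continuity_2d_pt fxy x y;
  C2_cyx : forall x y, U (x, y) -> continuity_2d_pt fyx x y;
  C2_cyy : forall x y, U (x, y) -> continuity_2d_pt fyy x y }.

Lemma open_locally_2d (U : C -> Prop) (x y : R) : open U -> U (x, y) ->
  locally_2d (fun u v => U (u, v)) x y.
Proof.
intros HU H. apply locally_2d_locally. specialize (HU _ H).
eapply filter_imp; [|exact HU]. intros [u v]; auto.
Qed.

Lemma open_locally_x (U : C -> Prop) (x y : R) : open U -> U (x, y) ->
  locally x (fun s => U (s, y)).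
Proof. intros HU H. apply (locally_2d_1d_const_y (fun u v => U (u, v))).
now apply open_locally_2d. Qed.

Lemma open_locally_y (U : C -> Prop) (x y : R) : open U -> U (x, y) ->
  locally y (fun t => U (x, t)).
Proof. intros HU H. apply (locally_2d_1d_const_x (fun u v => U (u, v))).
now apply open_locally_2d. Qed.

Lemma locally_2d_imp (P Q : R -> R -> Prop) (x y : R) :
  (forall u v, P u v -> Q u v) -> locally_2d P x y -> locally_2d Q x y.
Proof. intros H [d Hd]. exists d. auto. Qed.

(** [ex_diff_n] speaks of [Derive], which is known to equal the explicit partials only on [U]; as
    [U] is open, this is equality near the point. *)
Lemma C2_on_ex_diff_n (U : C -> Prop) (f fx fy fxx fxy fyx fyy : R -> R -> R) (x y : R) :
  open U -> C2_on U f fx fy fxx fxy fyx fyy -> U (x, y) -> ex_diff_n f 2 x y.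
Proof.
intros HU [] H.
assert (L := open_locally_2d U x y HU H).
assert (First : forall g gx gy, (forall x y, U (x,
y) -> is_derive (fun s => g s y) x (gx x y)) ->
  (forall x y, U (x, y) -> is_derive (fun t => g x t) y (gy x y)) ->
  (forall x y, U (x, y) -> continuity_2d_pt g x y) ->
  (forall x y, U (x, y) -> continuity_2d_pt gx x y) ->
  (forall x y, U (x, y) -> continuity_2d_pt gy x y) -> ex_diff_n g 1 x y).
{ intros g gx gy D1 D2 C0 C1 C2. simpl. split; [auto|]. split; [eexists; eauto|].
  split; [eexists; eauto|].
  split; (split; [|exact Logic.I]).
  - apply (continuity_2d_pt_ext_loc gx); auto. eapply locally_2d_imp; [|exact L].
    intros u v K. symmetry. apply is_derive_unique. auto.
  - apply (continuity_2d_pt_ext_loc gy); auto. eapply locally_2d_imp; [|exact L].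
    intros u v K. symmetry. apply is_derive_unique. auto. }
split; [auto|]. split; [eexists; eauto|]. split; [eexists; eauto|].
split.
- apply (ex_diff_n_ext_loc fx).
  + eapply locally_2d_imp; [|exact L]. intros u v K. symmetry. apply is_derive_unique. auto.
  + apply (First fx fxx fxy); auto.
- apply (ex_diff_n_ext_loc fy).
  + eapply locally_2d_imp; [|exact L]. intros u v K. symmetry. apply is_derive_unique. auto.
  + apply (First fy fyx fyy); auto.
Qed.

Lemma ex_diff_n_C2_on (U : C -> Prop) (f : R -> R -> R) :
  (forall x y, U (x, y) -> ex_diff_n f 2 x y) ->
  let fx := fun u v => Derive (fun z => f z v) u in
  let fy := fun u v => Derive (fun z => f u z) v in
  C2_on U f fx fy (fun u v => Derive (fun z => fx z v) u) (fun u v => Derive (fun z => fx u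
  z) v)
    (fun u v => Derive (fun z => fy z v) u) (fun u v => Derive (fun z => fy u z) v).
Proof.
intros H fx fy.
split; intros x y Hxy; destruct (H x y Hxy) as (K0 & K1 & K2 & (K3 & K4 & K5 & (K6 & _) & (K7
& _)) & (K8 & K9 & K10 & (K11 & _) & (K12 & _))); auto; now apply Derive_correct.
Qed.

Lemma C2_on_ln (U : C -> Prop) (f fx fy fxx fxy fyx fyy : R -> R -> R) :
  (forall x y, U (x, y) -> 0 < f x y) ->
  C2_on U f fx fy fxx fxy fyx fyy ->
  C2_on U (fun x y => ln (f x y)) (fun x y => fx x y / f x y) (fun x y => fy x y / f x y)
    (fun x y => (fxx x y * f x y - fx x y * fx x y) / (f x y * f x y))
    (fun x y => (fxy x y * f x y - fx x y * fy x y) / (f x y * f x y))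
    (fun x y => (fyx x y * f x y - fy x y * fx x y) / (f x y * f x y))
    (fun x y => (fyy x y * f x y - fy x y * fy x y) / (f x y * f x y)).
Proof.
intros Hp [].
assert (DL : forall g x l, is_derive g x l -> 0 < g x -> is_derive (fun s => ln (g s)) x (l /
g x)).
{ intros g x l Hg Hgx. replace (l / g x) with (scal l (/ g x)) by reflexivity.
  apply (is_derive_comp ln g); auto. now apply is_derive_Reals, derivable_pt_lim_ln. }
assert (DQ : forall g h x l m, is_derive g x l -> is_derive h x m -> 0 < h x ->
   is_derive (fun s => g s / h s) x ((l * h x - g x * m) / (h x * h x))).
{ intros g h x l m Hg Hh Hhx. replace (h x * h x) with (h x ^ 2) by ring.
  apply is_derive_div; auto. lra. }
assert (CD : forall g h x y, continuity_2d_pt g x y -> continuity_2d_pt h x y -> 0 < h x y ->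
   continuity_2d_pt (fun u v => g u v / h u v) x y).
{ intros g h x y Hg Hh Hhx. apply continuity_2d_pt_mult; auto.
  apply continuity_2d_pt_inv; auto. lra. }
assert (Hp2 : forall x y, U (x, y) -> 0 < f x y * f x y).
{ intros x y H. apply Rmult_lt_0_compat; auto. }
split; intros x y H.
- apply (DL (fun s => f s y)); auto.
- apply (DL (fun t => f x t)); auto.
- apply (DQ (fun s => fx s y) (fun s => f s y)); auto.
- apply (DQ (fun t => fx x t) (fun t => f x t)); auto.
- apply (DQ (fun s => fy s y) (fun s => f s y)); auto.
- apply (DQ (fun t => fy x t) (fun t => f x t)); auto.
- apply (continuity_1d_2d_pt_comp ln f); auto.
  apply derivable_continuous_pt. exists (/ f x y). now apply derivable_pt_lim_ln, Hp.
- apply CD; auto.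
- apply CD; auto.
- apply CD; auto. apply continuity_2d_pt_minus; apply continuity_2d_pt_mult; auto.
  apply continuity_2d_pt_mult; auto.
- apply CD; auto. apply continuity_2d_pt_minus; apply continuity_2d_pt_mult; auto.
  apply continuity_2d_pt_mult; auto.
- apply CD; auto. apply continuity_2d_pt_minus; apply continuity_2d_pt_mult; auto.
  apply continuity_2d_pt_mult; auto.
- apply CD; auto. apply continuity_2d_pt_minus; apply continuity_2d_pt_mult; auto.
  apply continuity_2d_pt_mult; auto.
Qed.

Lemma C2_on_laplacian (U : C -> Prop) (f fx fy fxx fxy fyx fyy : R -> R -> R) (x y : R) :
  open U -> C2_on U f fx fy fxx fxy fyx fyy -> U (x, y) ->
  laplacian f x y = fxx x y + fyy x y.
Proof.
intros HU [] H. unfold laplacian, partial_derive. simpl. f_equal.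
- rewrite (Derive_ext_loc _ (fun s => fx s y)).
  + now apply is_derive_unique, C2_xx0.
  + eapply filter_imp; [|exact (open_locally_x U x y HU H)].
    intros s K. now apply is_derive_unique, C2_x0.
- rewrite (Derive_ext_loc _ (fun t => fy x t)).
  + now apply is_derive_unique, C2_yy0.
  + eapply filter_imp; [|exact (open_locally_y U x y HU H)].
    intros s K. now apply is_derive_unique, C2_y0.
Qed.

Lemma C2_on_Schwarz (U : C -> Prop) (f fx fy fxx fxy fyx fyy : R -> R -> R) (x y : R) :
  open U -> C2_on U f fx fy fxx fxy fyx fyy -> U (x, y) -> fxy x y = fyx x y.
Proof.
intros HU [] H.
assert (Ex : forall u v, U (u, v) -> is_derive (fun z => Derive (fun t => f t z) u) v (fxy u
v)).
{ intros u v K. apply (is_derive_ext_loc (fun t => fx u t)); auto.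
  eapply filter_imp; [|exact (open_locally_y U u v HU K)].
  intros s K'. symmetry. now apply is_derive_unique, C2_x0. }
assert (Ey : forall u v, U (u, v) -> is_derive (fun z => Derive (fun t => f z t) v) u (fyx u
v)).
{ intros u v K. apply (is_derive_ext_loc (fun t => fy t v)); auto.
  eapply filter_imp; [|exact (open_locally_x U u v HU K)].
  intros s K'. symmetry. now apply is_derive_unique, C2_y0. }
assert (L := open_locally_2d U x y HU H).
rewrite <- (is_derive_unique _ _ _ (Ex x y H)), <- (is_derive_unique _ _ _ (Ey x y H)).
symmetry. apply Schwarz.
- eapply locally_2d_imp; [|exact L]. intros u v K. repeat split; eexists; eauto.
- apply (continuity_2d_pt_ext_loc fyx); auto. eapply locally_2d_imp; [|exact L].
  intros u v K. symmetry. apply is_derive_unique. auto.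
- apply (continuity_2d_pt_ext_loc fxy); auto. eapply locally_2d_imp; [|exact L].
  intros u v K. symmetry. apply is_derive_unique. auto.
Qed.

(** Of the two Cauchy-Riemann equations for [fx - i fy], one is harmonicity and the other is the
    symmetry of the mixed partials. *)
Lemma harmonic_gradient_Cdiff (U : C -> Prop) (f fx fy fxx fxy fyx fyy : R -> R -> R) (x y :
  R) :
  open U -> C2_on U f fx fy fxx fxy fyx fyy -> U (x, y) -> laplacian f x y = 0 ->
  Cdiff_at (fun z => (fx (fst z) (snd z), - fy (fst z) (snd z))) (x, y).
Proof.
intros HU HC H HL.
rewrite (C2_on_laplacian _ _ _ _ _ _ _ _ x y HU HC H) in HL.
assert (HS := C2_on_Schwarz _ _ _ _ _ _ _ _ x y HU HC H).
assert (L := open_locally_2d U x y HU H).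
destruct HC.
exists (fxx x y, - fyx x y).
apply (Cauchy_Riemann fx (fun x y => - fy x y)).
- rewrite Ropp_involutive, <- HS. apply C1_differentiable; auto.
  eapply locally_2d_imp; [|exact L]. auto.
- replace (fxx x y) with (- fyy x y) by lra.
  apply (C1_differentiable _ (fun x y => - fyx x y)).
  + eapply locally_2d_imp; [|exact L]. intros u v K. apply (is_derive_opp (fun z => fy z v)).
    auto.
  + apply (is_derive_opp (fun z => fy x z)). auto.
  + apply continuity_2d_pt_opp. auto.
Qed.

(** * The squared modulus of a holomorphic function *)

Lemma Cder_partials (F : C -> C) (x y : R) (l : C) : Cder F (x, y) l ->
  is_derive (fun s => fst (F (s, y))) x (fst l) /\
  is_derive (fun s => snd (F (s, y))) x (snd l) /\
  is_derive (fun t => fst (F (x, t))) y (- snd l) /\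
  is_derive (fun t => snd (F (x, t))) y (fst l).
Proof.
intros H.
assert (P1 := Pder_comp F (fun s => (s, y)) x _ _ H (Pder_Hline y x)).
assert (P2 := Pder_comp F (fun s => (x, s)) y _ _ H (Pder_Vline x y)).
refine (conj _ (conj _ (conj _ _))).
- replace (fst l) with (fst (RtoC 1 * l)%C) by (simpl; ring).
  exact (Pder_fst (fun s => F (s, y)) _ _ P1).
- replace (snd l) with (snd (RtoC 1 * l)%C) by (simpl; ring).
  exact (Pder_snd (fun s => F (s, y)) _ _ P1).
- replace (- snd l) with (fst (Ci * l)%C) by (simpl; ring).
  exact (Pder_fst (fun s => F (x, s)) _ _ P2).
- replace (fst l) with (snd (Ci * l)%C) by (simpl; ring).
  exact (Pder_snd (fun s => F (x, s)) _ _ P2).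
Qed.

Lemma Ccont_at_2d (F : C -> C) (x y : R) : Ccont_at F (x, y) ->
  continuity_2d_pt (fun u v => fst (F (u, v))) x y /\
  continuity_2d_pt (fun u v => snd (F (u, v))) x y.
Proof.
intros H.
assert (K : forall eps : posreal, locally_2d (fun u v => Cmod (F (u, v) - F (x,
y))%C < eps) x y).
{ intros eps. destruct (H eps (cond_pos eps)) as (r & Hr & K).
  assert (Hr2 : 0 < r / 2) by lra.
  exists (mkposreal _ Hr2). simpl. intros u v Hu Hv. apply K.
  eapply Rle_lt_trans; [apply Cmod_pair_le|]. lra. }
split; intros eps; (eapply locally_2d_imp; [|apply (K eps)]); intros u v Huv;
(eapply Rle_lt_trans; [|exact Huv]); (eapply Rle_trans; [|apply Rmax_Cmod]).
apply Rmax_l. apply Rmax_r.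
Qed.

Lemma hol_C_derive (U : C -> Prop) (F : C -> C) (z : C) : open U -> holomorphic_on U F -> U z ->
  Cder F z (C_derive F z) /\ Cdiff_at (C_derive F) z.
Proof.
intros HU HF Hz. split.
- destruct (HF z Hz) as [l Hl]. now rewrite (is_C_derive_unique F z l Hl).
- destruct (open_elim U z HU Hz) as (d & Hd & K).
  apply (C_derive_Cdiff F z (d / 2)); [lra|].
  intros w Hw. apply HF, K, Sq_Cmod, Hw.
Qed.

(** With [F = u + iv], [F' = p + iq], [F'' = p2 + i q2], the Cauchy-Riemann equations express every
    partial through [F], [F'], [F'']. Continuity of the second partials comes from differentiability
    of [F''], so [hol_C_derive] is iterated. *)
Lemma modulus_square_C2 (U : C -> Prop) (F : C -> C) :
  open U -> holomorphic_on U F ->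
  let u := fun x y => fst (F (x, y)) in let v := fun x y => snd (F (x, y)) in
  let p := fun x y => fst (C_derive F (x, y)) in let q := fun x y => snd (C_derive F (x, y)) in
  let p2 := fun x y => fst (C_derive (C_derive F) (x, y)) in
  let q2 := fun x y => snd (C_derive (C_derive F) (x, y)) in
  C2_on U (fun x y => Cmod (F (x, y)) ^ 2)
    (fun x y => 2 * (u x y * p x y + v x y * q x y))
    (fun x y => 2 * (v x y * p x y - u x y * q x y))
    (fun x y => 2 * ((p x y * p x y + q x y * q x y) + (u x y * p2 x y + v x y * q2 x y)))
    (fun x y => 2 * (v x y * p2 x y - u x y * q2 x y))
    (fun x y => 2 * (v x y * p2 x y - u x y * q2 x y))
    (fun x y => 2 * ((p x y * p x y + q x y * q x y) - (u x y * p2 x y + v x y * q2 x y))).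
Proof.
intros HU HF u v p q p2 q2.
set (F1 := C_derive F) in *. set (F2 := C_derive F1) in *.
assert (HF1 : holomorphic_on U F1) by (intros z Hz; now apply (hol_C_derive U)).
assert (HF2 : holomorphic_on U F2) by (intros z Hz; now apply (hol_C_derive U)).
assert (E : forall x y, u x y * u x y + v x y * v x y = Cmod (F (x, y)) ^ 2).
{ intros x y. rewrite Cmod2_alt. unfold u, v, Re, Im. ring. }
assert (D0 : forall x y, U (x, y) ->
  is_derive (fun s => u s y) x (p x y) /\ is_derive (fun s => v s y) x (q x y) /\
  is_derive (fun t => u x t) y (- q x y) /\ is_derive (fun t => v x t) y (p x y)).
{ intros x y H. apply (Cder_partials F x y (F1 (x, y))). now apply (hol_C_derive U). }
assert (D1 : forall x y, U (x, y) ->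
  is_derive (fun s => p s y) x (p2 x y) /\ is_derive (fun s => q s y) x (q2 x y) /\
  is_derive (fun t => p x t) y (- q2 x y) /\ is_derive (fun t => q x t) y (p2 x y)).
{ intros x y H. apply (Cder_partials F1 x y (F2 (x, y))). now apply (hol_C_derive U). }
assert (C0 : forall x y, U (x, y) -> continuity_2d_pt u x y /\ continuity_2d_pt v x y).
{ intros x y H. apply (Ccont_at_2d F). now apply Cdiff_cont, HF. }
assert (C1 : forall x y, U (x, y) -> continuity_2d_pt p x y /\ continuity_2d_pt q x y).
{ intros x y H. apply (Ccont_at_2d F1). now apply Cdiff_cont, HF1. }
assert (C2 : forall x y, U (x, y) -> continuity_2d_pt p2 x y /\ continuity_2d_pt q2 x y).
{ intros x y H. apply (Ccont_at_2d F2). now apply Cdiff_cont, HF2. }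
assert (DP : forall (a b c d : R -> R) x a' b' c' d', is_derive a x a' -> is_derive b x b' ->
   is_derive c x c' -> is_derive d x d' ->
   is_derive (fun s => 2 * (a s * b s + c s * d s)) x (2 * ((a' * b x + a x * b') + (c' * d x
   + c x * d')))).
{ intros. apply @is_derive_scal.
  apply @is_derive_plus; apply (is_derive_mult a b) || apply (is_derive_mult c d); auto;
  intros; apply Rmult_comm. }
assert (DM : forall (a b c d : R -> R) x a' b' c' d', is_derive a x a' -> is_derive b x b' ->
   is_derive c x c' -> is_derive d x d' ->
   is_derive (fun s => 2 * (a s * b s - c s * d s)) x (2 * ((a' * b x + a x * b') - (c' * d x
   + c x * d')))).
{ intros. apply @is_derive_scal.
  apply @is_derive_minus; apply (is_derive_mult a b) || apply (is_derive_mult c d); auto;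
  intros; apply Rmult_comm. }
assert (DE : forall (f : R -> R) x l m,
l = m -> is_derive f x l -> is_derive f x m) by (intros; now subst).
assert (C2c : forall x y, continuity_2d_pt (fun _ _ => 2) x y) by (intros;
apply continuity_2d_pt_const).
split; intros x y H;
 destruct (D0 x y H) as (U1 & U2 & U3 & U4); destruct (D1 x y H) as (V1 & V2 & V3 & V4);
 destruct (C0 x y H) as (X1 & X2); destruct (C1 x y H) as (X3 & X4);
 destruct (C2 x y H) as (X5 & X6).
(* The factor [/ 2 * 2] brings the function into the shape of [DP]. *)
- apply (is_derive_ext (fun s => / 2 * (2 * (u s y * u s y + v s y * v s y)))).
  { intros s. rewrite <- E. simpl. lra. }
  eapply DE; [|apply @is_derive_scal, DP; eassumption].
  unfold scal; simpl; unfold mult; simpl. field.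
- apply (is_derive_ext (fun t => / 2 * (2 * (u x t * u x t + v x t * v x t)))).
  { intros s. rewrite <- E. simpl. lra. }
  eapply DE; [|apply @is_derive_scal, DP; eassumption].
  unfold scal; simpl; unfold mult; simpl. field.
- eapply DE; [|apply DP; eassumption]. simpl. ring.
- eapply DE; [|apply DP; eassumption]. simpl. ring.
- eapply DE; [|apply DM; eassumption]. simpl. ring.
- eapply DE; [|apply DM; eassumption]. simpl. ring.
- apply (continuity_2d_pt_ext (fun x y => u x y * u x y + v x y * v x y)); [exact E|].
  apply continuity_2d_pt_plus; now apply continuity_2d_pt_mult.
- apply continuity_2d_pt_mult; auto.
  apply continuity_2d_pt_plus; now apply continuity_2d_pt_mult.
- apply continuity_2d_pt_mult; auto.
  apply continuity_2d_pt_minus; now apply continuity_2d_pt_mult.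
- apply continuity_2d_pt_mult; auto.
  apply continuity_2d_pt_plus; apply continuity_2d_pt_plus; now apply continuity_2d_pt_mult.
- apply continuity_2d_pt_mult; auto.
  apply continuity_2d_pt_minus; now apply continuity_2d_pt_mult.
- apply continuity_2d_pt_mult; auto.
  apply continuity_2d_pt_minus; now apply continuity_2d_pt_mult.
- apply continuity_2d_pt_mult; auto.
  apply continuity_2d_pt_minus; apply continuity_2d_pt_plus; now apply continuity_2d_pt_mult.
Qed.

(** The [F''] terms cancel in the Laplacian of [|F|^2], leaving [4 |F'|^2], while the squared
    gradient of [|F|^2] is [4 |F|^2 |F'|^2]; the numerator from the quotient rule is therefore
    zero. *)
Lemma log_modulus_harmonic (U : C -> Prop) (F : C -> C) (x y : R) :
  open U -> holomorphic_on U F -> (forall z, U z -> F z <> RtoC 0) -> U (x, y) ->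
  laplacian (fun x y => ln (Cmod (F (x, y)) ^ 2)) x y = 0.
Proof.
intros HU HF H0 H.
assert (Hp : forall x y, U (x, y) -> 0 < Cmod (F (x, y)) ^ 2).
{ intros s t K. apply pow_lt, Cmod_gt_0. auto. }
rewrite (C2_on_laplacian _ _ _ _ _ _ _ _ x y HU (C2_on_ln _ _ _ _ _ _ _ _ Hp
(modulus_square_C2 U F HU HF)) H).
specialize (Hp x y H). rewrite Cmod2_alt in *. unfold Re, Im in *.
field. lra.
Qed.

(** * The Cauchy problem *)

Lemma C2_on_ln_solution (I : R -> Prop) (a d : R -> R) (V : C -> Prop) (phi : R -> R -> R) :
  cauchy_solution_on I a d V phi ->
  exists wx wy wxx wxy wyx wyy,
    C2_on V (fun x y => ln (phi x y)) wx wy wxx wxy wyx wyy.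
Proof.
intros [H _]. do 6 eexists. apply C2_on_ln.
- intros x y K. now apply H.
- apply ex_diff_n_C2_on. intros x y K. now apply H.
Qed.

(** On the real segment the s-derivatives of both logarithms agree because both solutions equal [a]
    there, and both t-derivatives are [d / a]. *)
Lemma cauchy_solution_unique_near (I : R -> Prop) (a d : R -> R) (U V : C -> Prop)
    (phi psi : R -> R -> R) (s0 r : R) :
  open U -> open V ->
  cauchy_solution_on I a d U phi -> cauchy_solution_on I a d V psi -> 0 < r ->
  (forall z, Sq (RtoC s0) r z -> U z /\ V z) ->
  (forall s, Rabs (s - s0) < r -> I s) ->
  forall x y, Cmod ((x, y) - RtoC s0)%C < r -> phi x y = psi x y.
Proof.
intros HU HV SU SV Hr HS HI.
destruct (C2_on_ln_solution I a d U phi SU) as (ux & uy & uxx & uxy & uyx & uyy & CU).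
destruct (C2_on_ln_solution I a d V psi SV) as (vx & vy & vxx & vxy & vyx & vyy & CV).
destruct SU as [SU1 SU2], SV as [SV1 SV2].
set (G := fun z : C => Cminus (ux (fst z) (snd z), - uy (fst z) (snd z)) (vx (fst z) (snd z),
- vy (fst z) (snd z))).
assert (HG : holomorphic_on (Sq (RtoC s0) r) G).
{ intros [x y] Hz. destruct (HS _ Hz) as [KU KV].
  destruct (harmonic_gradient_Cdiff U _ _ _ _ _ _ _ x y HU CU KU) as [l Hl]. now apply SU1.
  destruct (harmonic_gradient_Cdiff V _ _ _ _ _ _ _ x y HV CV KV) as [m Hm]. now apply SV1.
  eexists. exact (Cder_minus _ _ _ _ _ Hl Hm). }
assert (Real : forall s, Rabs (s - s0) < r -> Sq (RtoC s0) r (s, 0)).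
{ intros s Hs. split; simpl; auto. rewrite Rminus_0_r, Rabs_R0; lra. }
assert (Hy : forall w (phi : R -> R -> R) x, I x -> phi x 0 = a x ->
   Derive (fun t => phi x t) 0 = d x -> 0 < phi x 0 -> ex_derive (fun t => phi x t) 0 ->
   is_derive (fun t => ln (phi x t)) 0 w -> w = d x / a x).
{ intros w f x Ix E1 E2 Hp Ex Hw.
  assert (D : is_derive (fun t => ln (f x t)) 0 (d x / a x)).
  { rewrite <- E1, <- E2. apply (is_derive_comp ln (fun t => f x t)).
    now apply is_derive_Reals, derivable_pt_lim_ln. now apply Derive_correct. }
  rewrite <- (is_derive_unique _ _ _ Hw). now apply is_derive_unique. }
assert (G0 : forall s, Rabs s < r -> G (RtoC s0 + RtoC s)%C = RtoC 0).
{ intros s Hs. rewrite <- RtoC_plus. set (x := s0 + s).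
  assert (Hx : Rabs (x - s0) < r) by (unfold x; replace (s0 + s - s0) with s by ring; auto).
  assert (Ix := HI x Hx). destruct (HS _ (Real x Hx)) as [KU KV].
  destruct (SU2 x Ix) as [E1 E2]. destruct (SV2 x Ix) as [E3 E4].
  destruct (SU1 _ _ KU) as (XU & PU & _). destruct (SV1 _ _ KV) as (XV & PV & _).
  assert (EX : ux x 0 = vx x 0).
  { rewrite <- (is_derive_unique _ _ _ (C2_x _ _ _ _ _ _ _ _ CU x 0 KU)).
    apply is_derive_unique.
    apply (is_derive_ext_loc (fun s => ln (psi s 0))).
    2: apply (C2_x _ _ _ _ _ _ _ _ CV x 0 KV).
    assert (Hd : 0 < r - Rabs (x - s0)) by lra.
    exists (mkposreal _ Hd). intros t Ht.
    change (Rabs (t - x) < r - Rabs (x - s0)) in Ht.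
    assert (It : I t).
    { apply HI. replace (t - s0) with ((t - x) + (x - s0)) by ring.
      eapply Rle_lt_trans; [apply Rabs_triang|]. lra. }
    destruct (SU2 t It) as [-> _]. now destruct (SV2 t It) as [-> _]. }
  assert (EY : uy x 0 = vy x 0).
  { transitivity (d x / a x); [|symmetry].
    - apply (Hy (uy x 0) phi); auto. apply XU. apply (C2_y _ _ _ _ _ _ _ _ CU x 0 KU).
    - apply (Hy (vy x 0) psi); auto. apply XV. apply (C2_y _ _ _ _ _ _ _ _ CV x 0 KV). }
  unfold G; simpl. rewrite EX, EY. apply injective_projections; simpl; ring. }
intros x y Hxy.
(* The disc is centred on the real axis, so it contains the vertical segment from that axis to any
   of its points. *)
assert (Hsq : forall t, between 0 y t -> Cmod ((x, t) - RtoC s0)%C < r).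
{ intros t Ht. eapply Rle_lt_trans; [|exact Hxy].
  unfold Cmod; simpl. apply sqrt_le_1_alt.
  assert (t * t <= y * y). { unfold between, Rmin, Rmax in Ht; destruct Rle_dec; nra. }
  nra. }
assert (GZ : forall t, between 0 y t -> uy x t = vy x t).
{ intros t Ht. assert (E := identity_principle G (RtoC s0) (x, t) r r HG Hr G0 (Hsq t Ht)).
  unfold G in E; simpl in E. injection E. intros E1 _. lra. }
assert (KK : forall t, between 0 y t -> U (x, t) /\ V (x, t)).
{ intros t Ht. now apply HS, Cmod_lt_Sq, Hsq. }
set (e := fun t => ln (phi x t) - ln (psi x t)).
assert (De : forall t, between 0 y t -> is_derive e t 0).
{ intros t Ht. destruct (KK t Ht) as [KU KV].
  replace 0 with (uy x t - vy x t) by (rewrite GZ; auto; ring).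
  apply (is_derive_minus (fun t => ln (phi x t)) (fun t => ln (psi x t))).
  apply (C2_y _ _ _ _ _ _ _ _ CU x t KU). apply (C2_y _ _ _ _ _ _ _ _ CV x t KV). }
assert (Ee : e 0 = e y).
{ destruct (Rtotal_order 0 y) as [H|[<-|H]]; auto; [|symmetry];
  apply (@eq_is_derive R_NormedModule e); auto; intros t Ht; apply De;
  unfold between, Rmin, Rmax; destruct Rle_dec; lra. }
assert (Ix : I x).
{ apply HI. apply (Cmod_lt_Sq (RtoC s0) (x, y) r Hxy). }
assert (E0 : e 0 = 0).
{ unfold e. destruct (SU2 x Ix) as [-> _], (SV2 x Ix) as [-> _]. ring. }
destruct (KK y (between_r _ _)) as [KU KV].
apply ln_inv. now apply SU1. now apply SV1.
unfold e in *; lra.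
Qed.

(** [W] is the union of the discs to which the local lemma applies; equality is pointwise, so the
    discs need not be matched with each other. *)
Lemma cauchy_solution_unique (I : R -> Prop) (a d : R -> R) (U V : C -> Prop)
    (phi psi : R -> R -> R) :
  is_open_interval I -> nbhd_of I U -> nbhd_of I V ->
  cauchy_solution_on I a d U phi -> cauchy_solution_on I a d V psi ->
  exists W : C -> Prop, nbhd_of I W /\ forall s t : R, W (s, t) -> phi s t = psi s t.
Proof.
intros hI [HU IU] [HV IV] SU SV.
set (ok := fun s r => 0 < r /\ (forall z, Sq (RtoC s) r z -> U z /\ V z) /\
   (forall t, Rabs (t - s) < r -> I t)).
exists (fun z => exists s r, ok s r /\ Cmod (z - RtoC s)%C < r).
split; [split|].
- apply open_intro. intros z (s & r & Hok & Hz).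
  exists (r - Cmod (z - RtoC s)%C). split; [lra|]. intros w Hw. exists s, r. split; auto.
  replace (w - RtoC s)%C with ((w - z) + (z - RtoC s))%C by ring.
  eapply Rle_lt_trans; [apply Cmod_triangle|]. lra.
- intros s Hs.
  destruct (open_elim U _ HU (IU s Hs)) as (d1 & Hd1 & K1).
  destruct (open_elim V _ HV (IV s Hs)) as (d2 & Hd2 & K2).
  destruct (open_interval_open I s hI Hs) as (d3 & Hd3 & K3).
  exists s, (Rmin (d1 / 2) (Rmin (d2 / 2) d3)).
  assert (Hm : 0 < Rmin (d1 / 2) (Rmin (d2 / 2) d3)) by (repeat apply Rmin_pos; lra).
  split; [split; [auto|split]|].
  + intros z Hz. split.
    * apply K1, Sq_Cmod. eapply Sq_mono; [|exact Hz]. apply Rmin_l.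
    * apply K2, Sq_Cmod. eapply Sq_mono; [|exact Hz].
      eapply Rle_trans; [apply Rmin_r|apply Rmin_l].
  + intros t Ht. apply K3. eapply Rlt_le_trans; [exact Ht|].
    eapply Rle_trans; [apply Rmin_r|apply Rmin_r].
  + replace (RtoC s - RtoC s)%C with (RtoC 0) by ring. rewrite Cmod_0; auto.
- intros x y (s & r & (Hr & H1 & H2) & Hz).
  exact (cauchy_solution_unique_near I a d U V phi psi s r HU HV SU SV Hr H1 H2 x y Hz).
Qed.

Lemma extension_local (I : R -> Prop) (g : R -> R) (F : C -> C) (s : R) :
  is_open_interval I -> holomorphic_extension I g F -> I s ->
  exists r, 0 < r /\ local_ext g s r F.
Proof.
intros hI [(U & [HU IU] & HF) HE] Hs.
destruct (open_elim U _ HU (IU s Hs)) as (d1 & Hd1 & K1).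
destruct (open_interval_open I s hI Hs) as (d3 & Hd3 & K3).
exists (Rmin (d1 / 2) d3). split. apply Rmin_pos; lra. split.
- intros z Hz. apply HF, K1, Sq_Cmod. eapply Sq_mono; [|exact Hz]. apply Rmin_l.
- intros t Ht. apply HE, K3. eapply Rlt_le_trans; [exact Ht|apply Rmin_r].
Qed.

Theorem theorem6 (I : R -> Prop) (a d : R -> R) (s0 : R)
    (hI : is_open_interval I)
    (ha : real_analytic_on I a)
    (hd : real_analytic_on I d)
    (a_pos : forall s : R, I s -> 0 < a s)
    (hs0 : I s0) :
  (exists A : C -> C, holomorphic_extension I (fun s => sqrt (a s)) A) /\
  (exists T : C -> C, holomorphic_extension I (theta_from a d s0) T) /\
  (forall A T : C -> C,
     holomorphic_extension I (fun s => sqrt (a s)) A ->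
     holomorphic_extension I (theta_from a d s0) T ->
     let f := fun z : C => Cmult (A z) (Cexp (Cmult Ci (T z))) in
     let phi0 := fun s t : R => (Cmod (f (s, t))) ^ 2 in
     holomorphic_near I f /\
     (exists U : C -> Prop, nbhd_of I U /\ cauchy_solution_on I a d U phi0) /\
     (forall (V : C -> Prop) (phi : R -> R -> R),
        nbhd_of I V -> cauchy_solution_on I a d V phi ->
        exists W : C -> Prop,
          nbhd_of I W /\ forall s t : R, W (s, t) -> phi s t = phi0 s t)).
Proof.
split; [|split].
- apply glue_extensions. intros x Hx.
  destruct (analytic_local_ext I a x ha Hx) as (r & H & Hr & L).
  exact (sqrt_local_ext a x r H Hr L (a_pos x Hx)).
- apply glue_extensions. intros x Hx. now apply (theta_local_ext I).
- intros A T HA HT f phi0.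
  assert (fD : forall z l m, Cder A z l -> Cder T z m ->
    Cder f z (l * Cexp (Ci * T z) + A z * (Cexp (Ci * T z) * (Ci * m)))%C).
  { intros z l m Hl Hm. apply (Cder_mult A (fun z => Cexp (Ci * T z)%C)); auto.
    apply (Cder_comp Cexp). apply Cder_Cexp. now apply Cder_scal. }
  destruct (proj1 HA) as (UA & [OA IA] & DA). destruct (proj1 HT) as (UT & [OT IT] & DT).
  set (U0 := fun z => UA z /\ UT z).
  assert (O0 : open U0) by now apply open_and.
  assert (D0 : holomorphic_on U0 f).
  { intros z [H1 H2]. destruct (DA z H1) as [l Hl]. destruct (DT z H2) as [m Hm].
    eexists. exact (fD _ _ _ Hl Hm). }
  assert (Nf : holomorphic_near I f).
  { exists U0. split; [split; [exact O0|]|exact D0]. intros s Hs; split; auto. }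
  (* [A] may have zeros away from [I]; removing the zeros of [f] keeps an open neighbourhood of [I]
     on which [phi0] is positive. *)
  set (U := fun z => U0 z /\ f z <> RtoC 0).
  assert (OU : open U).
  { apply open_intro. intros z [H1 H2].
    destruct (open_elim U0 z O0 H1) as (d1 & Hd1 & K1).
    assert (P := proj1 (Cmod_gt_0 _) H2).
    destruct (Cdiff_cont f z (D0 z H1) _ P) as (d2 & Hd2 & K2).
    exists (Rmin d1 d2). split; [now apply Rmin_pos|]. intros w Hw. split.
    - apply K1. eapply Rlt_le_trans; [exact Hw|apply Rmin_l].
    - intros E. specialize (K2 w (Rlt_le_trans _ _ _ Hw (Rmin_r _ _))).
      rewrite E in K2. replace (RtoC 0 - f z)%C with (- f z)%C in K2 by ring.
      rewrite Cmod_opp in K2. lra. }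
  assert (HolU : holomorphic_on U f) by (intros z [H1 _]; auto).
  assert (fs : forall s, I s -> f (RtoC s) = (RtoC (sqrt (a s)) * eit (theta_from a d s0 s))%C).
  { intros s Hs. unfold f. rewrite (proj2 HA), (proj2 HT) by auto. f_equal.
    unfold Cexp, eit; simpl. replace (0 * theta_from a d s0 s - 1 * 0) with 0 by ring.
    replace (0 * 0 + 1 * theta_from a d s0 s) with (theta_from a d s0 s) by ring.
    rewrite exp_0, !Rmult_1_l. reflexivity. }
  assert (NU : nbhd_of I U).
  { split; auto. intros s Hs. split; [split; auto|]. rewrite fs by auto.
    apply Cmult_neq_0.
    - intros E; apply RtoC_inj in E. generalize (sqrt_lt_R0 _ (a_pos s Hs)); lra.
    - apply Cmod_gt_0. rewrite Cmod_eit; lra. }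
  assert (SU : cauchy_solution_on I a d U phi0).
  { split.
    - intros s t H. split; [|split].
      + exact (C2_on_ex_diff_n U _ _ _ _ _ _ _ s t OU (modulus_square_C2 U f OU HolU) H).
      + apply pow_lt, Cmod_gt_0, H.
      + apply (log_modulus_harmonic U f s t OU HolU); auto. intros z Hz; apply Hz.
    - intros s Hs.
      assert (Us : U (s, 0)) by (apply NU; auto).
      assert (Hsa : sqrt (a s) * sqrt (a s) = a s) by (apply sqrt_sqrt; left; auto).
      assert (Pa := a_pos s Hs).
      split.
      + unfold phi0. change (s, 0) with (RtoC s). rewrite fs by auto.
        rewrite Cmod_mult, Cmod_eit, Cmod_R, Rabs_pos_eq by apply sqrt_pos. simpl. lra.
      + etransitivity; [exact (is_derive_unique _ _ _ (C2_y _ _ _ _ _ _ _ _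
        (modulus_square_C2 U f OU HolU) s 0 Us))|].
        cbv beta.
        (* On [I] the derivatives [l] of [A] and [m] of [T] are real, and [m] is the derivative of
           theta. *)
        destruct (extension_local I _ A s hI HA Hs) as (r1 & Hr1 & L1).
        destruct (extension_local I _ T s hI HT Hs) as (r2 & Hr2 & L2).
        assert (Z : forall r, 0 < r -> Rabs (s - s) < r) by (intros;
        now rewrite Rminus_diag, Rabs_R0).
        destruct (DA (RtoC s) (IA s Hs)) as [l Hl]. destruct (DT (RtoC s) (IT s Hs)) as [m Hm].
        destruct (local_ext_derive _ s r1 s A l L1 (Z _ Hr1) Hl) as [_ Ql].
        destruct (local_ext_derive _ s r2 s T m L2 (Z _ Hr2) Hm) as [Pm Qm].
        assert (Em : fst m = - (1 / 2) * (d s / a s)).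
        { rewrite <- (is_derive_unique _ _ _ Pm). apply is_derive_unique.
          now apply (theta_derive I). }
        rewrite (is_C_derive_unique f (s, 0) _ (fD _ _ _ Hl Hm)).
        change (s, 0) with (RtoC s). rewrite fs, (proj2 HA), (proj2 HT) by auto.
        replace (Cexp (Ci * RtoC (theta_from a d s0 s))%C) with (eit (theta_from a d s0 s)).
        2:{ unfold Cexp, eit; simpl. replace (0 * theta_from a d s0 s - 1 * 0) with 0 by ring.
            replace (0 * 0 + 1 * theta_from a d s0 s) with (theta_from a d s0 s) by ring.
            rewrite exp_0, !Rmult_1_l. reflexivity. }
        destruct l as [l1 l2], m as [m1 m2]. simpl in Ql, Qm, Em. subst l2 m2 m1.
        set (th := theta_from a d s0 s). unfold eit; simpl.
        assert (CS : sin th * sin th + cos th * cos th = 1) by apply sin2_cos2.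
        (* The t-derivative of [|f|^2] is [-2 Im (conj f * f')] with [f' = (l + i m A) e^(i theta)].
           The real [l] drops out, and [-2 a m = d] remains; this fixes the factor [-1/2] in
           theta. *)
        match goal with |- ?lhs = _ => replace lhs with
          (sqrt (a s) * sqrt (a s) * (sin th * sin th + cos th * cos th) * (d s / a s)) by
          (field; lra) end.
        rewrite CS, Hsa. field; lra. }
  split; [exact Nf|]. split; [now exists U|].
  intros V phi HV SV.
  exact (cauchy_solution_unique I a d V U phi phi0 hI HV NU SV SU).
Qed.
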